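(* For every fixed real $\gamma\in(0,1)$ there are constants $c>0$ and $C=C(\gamma)>0$ such that if the edge-probability $p=p(n)$ satisfies $n^{-2}\ll p\le 1-\gamma$, then with high probability $$ c\,\frac{n^2p}{(\log_{1/p}n)^2}\;\le\;\mathrm{cc}(G_{n,p})\;\le\;\mathrm{cp}(G_{n,p})\;\le\;C\,\frac{n^2p}{(\log_{1/p}n)^2}. $$
   Context: The binomial random graph $G_{n,p}$ has vertex set $[n]$, and each of the $\binom n2$ possible edges is included independently with probability $p$. ''With high probability'' means with probability tending to $1$ as $n\to\infty$. The notation $a_n\ll b_n$ means $a_n/b_n\to0$ as $n\to\infty$, and $\log_{1/p}n=\log n/\log(1/p)$. For a graph $G$, the clique covering number $\mathrm{cc}(G)$ is the minimum number of cliques (complete subgraphs) in $G$ that cover the edge-set of $G$, i.e., every edge lies in at least one of them. The clique partition number $\mathrm{cp}(G)$ is the minimum number of cliques in $G$ that partition the edge-set of $G$, i.e., every edge lies in exactly one of them. *)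

(* Defs.v *)
From HB Require Import structures.
From mathcomp Require Import all_boot all_order all_algebra.
From mathcomp Require Import all_classical all_reals all_analysis.

Set Implicit Arguments.
Unset Strict Implicit.
Unset Printing Implicit Defensive.

Import Order.TTheory GRing.Theory Num.Theory.
Import numFieldNormedType.Exports.

Local Open Scope classical_set_scope.
Local Open Scope ring_scope.

Definition vpairs (T : finType) : {set {set T}} :=
  [set e : {set T} | #|e| == 2]%SET.

Record sgraph (T : finType) := SGraph {
  edges : {set {set T}};
  edges_vpairs : edges \subset vpairs T }.

HB.instance Definition _ (T : finType) := [isSub for @edges T].
HB.instance Definition _ (T : finType) := [Finite of sgraph T by <:].

Section Cliques.
Variables (T : finType) (G : sgraph T).
Implicit Types (Q : {set T}) (F : {set {set T}}).

Definition clique Q : bool :=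
  [forall x in Q, forall y in Q, (x != y) ==> ([set x; y]%SET \in edges G)].

(* Cliques are given by their vertex sets, so a two-element vertex set [e]
   is an edge of the clique on [Q] exactly when [e \subset Q].  Families are
   sets rather than multisets of cliques; repeating a clique never lowers the
   size of a covering or of a partition. *)
Definition clique_covering F : bool :=
  [forall Q in F, clique Q]
  && [forall e in edges G, [exists Q in F, e \subset Q]].

Definition clique_partition F : bool :=
  [forall Q in F, clique Q]
  && [forall e in edges G, #|[set Q in F | e \subset Q]%SET| == 1%N].

Lemma clique_partition_covering F : clique_partition F -> clique_covering F.
Proof.
case/andP=> HF /forall_inP Hp; rewrite /clique_covering HF /=.
apply/forall_inP => e /Hp /cards1P[Q HQ]; apply/existsP; exists Q.
by have := finset.set11 Q; rewrite -HQ inE.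
Qed.

Lemma edges_clique_partition : clique_partition (edges G).
Proof.
have card_edge e : e \in edges G -> #|e| = 2.
  by move/(fintype.subsetP (edges_vpairs G)); rewrite inE => /eqP.
apply/andP; split; apply/forall_inP => e eG.
  apply/forall_inP => x xe; apply/forall_inP => y ye; apply/implyP => xy.
  suff -> : [set x; y]%SET = e by [].
  apply/eqP; rewrite eqEcard finset.subUset !finset.sub1set xe ye /=.
  by rewrite (card_edge _ eG) cards2 xy.
apply/cards1P; exists e; apply/finset.setP => Q; rewrite !inE.
apply/andP/eqP => [[QG eQ]|-> //].
by apply/esym/eqP; rewrite eqEcard eQ !card_edge.
Qed.

Lemma ex_clique_covering :
  exists k : nat, [exists F, clique_covering F && (#|F| == k)].
Proof.
exists #|edges G|; apply/existsP; exists (edges G).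
by rewrite eqxx andbT; apply/clique_partition_covering/edges_clique_partition.
Qed.

Lemma ex_clique_partition :
  exists k : nat, [exists F, clique_partition F && (#|F| == k)].
Proof.
exists #|edges G|; apply/existsP; exists (edges G).
by rewrite eqxx andbT edges_clique_partition.
Qed.

Definition cc : nat := ex_minn ex_clique_covering.

Definition cp : nat := ex_minn ex_clique_partition.

End Cliques.

Section BinomialRandomGraph.
Variable R : realType.

Definition gnp_mass (n : nat) (p : R) (G : sgraph 'I_n) : R :=
  \prod_(e in vpairs 'I_n) (if e \in edges G then p else 1 - p).

Definition gnp_prob (n : nat) (p : R) (A : pred (sgraph 'I_n)) : R :=
  \sum_(G | A G) gnp_mass p G.

Lemma gnp_mass_ge0 n (p : R) (G : sgraph 'I_n) :
  0 <= p <= 1 -> 0 <= gnp_mass p G.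
Proof.
by case/andP=> p0 p1; apply: prodr_ge0 => e _; case: ifP; rewrite ?subr_ge0.
Qed.

Lemma gnp_probT n (p : R) : gnp_prob p (xpredT : pred (sgraph 'I_n)) = 1.
Proof.
pose V := vpairs 'I_n.
pose f e := if e \in V then p else 0.
pose g e := if e \in V then 1 - p else 1.
have fg1 : \prod_e (f e + g e) = 1.
  by rewrite big1 // => e _; rewrite /f /g; case: ifP; rewrite ?add0r ?subrKC.
rewrite -fg1 bigA_distr.
rewrite (bigID (fun E : {set {set 'I_n}} => E \subset V)) /=.
rewrite [X in _ = _ + X]big1 ?addr0 => [|E /fintype.subsetPn[e eE eV]]; last first.
  by rewrite (bigD1 e) //= eE /f (negbTE eV) mul0r.
rewrite /gnp_prob.
have mE (E : {set {set 'I_n}}) : E \subset V ->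
    \prod_e (if e \in E then f e else g e) =
    \prod_(e in V) (if e \in E then p else 1 - p).
  move=> /fintype.subsetP EV; rewrite [RHS]big_mkcond; apply: eq_bigr => e _ /=.
  rewrite /f /g; case: (boolP (e \in V)) => // /negP eV.
  by case: ifP => // /EV.
rewrite (reindex_omap (@edges 'I_n) (fun E => insub E : option (sgraph 'I_n))).
  by apply: eq_big => [G|G _]; rewrite ?valK ?eqxx ?edges_vpairs ?mE ?edges_vpairs.
by move=> E /= EV; rewrite insubT.
Qed.

(* [E n] is an event for the random graph on [n] vertices. *)
Definition whp (p : nat -> R) (E : forall n, pred (sgraph 'I_n)) : Prop :=
  gnp_prob (p n) (E n) @[n --> \oo] --> (1 : R).

(* The nonvanishing condition is needed because division by zero yields zero:
   without it, every sequence would be much smaller than the zero sequence. *)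
Definition much_less (a b : nat -> R) : Prop :=
  (\forall n \near \oo, b n != 0) /\ a n / b n @[n --> \oo] --> (0 : R).

Definition log_base (b x : R) : R := ln x / ln b.

End BinomialRandomGraph.

(* Main.v *)
Require Import Defs.
From mathcomp Require Import all_boot all_order all_algebra.
From mathcomp Require Import all_classical all_reals all_analysis.
From mathcomp Require Import ring lra.
From mathcomp Require Import fintype finset.
Import Order.TTheory GRing.Theory Num.Theory.
Import numFieldNormedType.Exports.

Set Implicit Arguments.
Unset Strict Implicit.
Unset Printing Implicit Defensive.

Local Open Scope set_scope.
Local Open Scope ring_scope.

(** * Clique coverings and clique partitions of the binomial random graph

Write N for the number of pairs of vertices and L for the base-1/p logarithm
of n.

The lower bound is a first moment computation.  With high probability the
graph has at least Np/2 edges ([edges_deviation]) and no clique on 2m+1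
vertices, where m is slightly larger than 2L ([large_cliques]).  A clique then
covers at most 2m^2 = O(L^2) edges ([cc_lower_bound]).

For the upper bound let f(A) be the least number of cliques on at most ln n
vertices that partition the edge set A.  The bound on the expectation F(p) of f
comes from a differential inequality in the density.  For a clique Q on
s vertices with pair set K,

      f(A union K) - f(A minus K) <= 1,                                 (1)

since one clique accounts for all of K.  Take expectations in (1) and average
over all s-sets Q.  Were the increments of f additive, the left side would be
the average over Q of the sum, over the pairs e in Q, of the expected increment
of f at e, that is binom(s,2)/N times F'(p), by the Margulis-Russo formula
([is_derive_expect]).  One would get F'(p) <= N / binom(s,2).

The error in this additive approximation is a covariance.  Forcing K to be
present, or absent, is a change of measure ([expect_force]), so the left side
of (1) has expectation E[f d_K] for an explicit d_K ([tilt]), and the error for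
Q is E[f w_K], where w_K is d_K minus the sum of the d_{e} for e in K
([nonlinear_tilt]).  Subtracting this linear part makes w_K and w_K'
uncorrelated unless the two vertex sets share at least three vertices
([expect_nonlinear_tilt_mul]), so the average W of w_K over Q has second moment
at most about n^(-5/2) ([nonlinear_sum_sq_le]).  On the other
hand, one pair changes f by at most (ln n)^2, so f has variance at most about
n^2, up to logarithms, by the Efron-Stein inequality ([variance_le]).  Hence
|E[f W]| tends to 0 and the additive heuristic is right up to a constant factor
([block_slope_le]).

This is valid for s a small multiple of ln n / ln(1/p), with a constant that
depends on how far p stays from 1, and gives
F'(q) = O(n^2 (c + ln(1/q))^2 / (ln n)^2) at every density q.  The right side
is comparable with the derivative of n^2 q (c + ln(1/q))^2 / (ln n)^2, whence
F(p) = O(n^2 p / L^2) ([expect_block_cost_le]); the sparser the graph, the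
smaller the cliques, but the fewer the edges that remain.  The variance bound
also yields concentration when np >= 1 ([cost_deviation]).  When np < 1
one has L <= 1 and the partition into single edges is good enough
([cp_upper_bound_sparse]). *)

(** * Random subsets of a finite set *)
Section RandomSubset.
Variables (R : realType) (T : finType).
Implicit Types (V K A : {set T}) (p : R) (f g : {set T} -> R).

(** Each element of [V] is kept independently with probability [p]. *)
Definition expect V p f : R :=
  \sum_(A : {set T} | A \subset V) p ^+ #|A| * (1 - p) ^+ #|V :\: A| * f A.

Lemma expect_split e V p f : e \in V ->
  expect V p f = p * expect (V :\ e) p (fun A => f (e |: A))
               + (1 - p) * expect (V :\ e) p f.
Proof.
move=> eV; rewrite /expect (bigID (fun A => e \in A)) /=; congr (_ + _).
  rewrite big_distrr /= (reindex_onto (fun A => e |: A) (fun A => A :\ e)) /=.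
    apply: eq_big => [A|A].
      rewrite subsetD1 subUset sub1set eV setU11 andbT /=.
      case: (boolP (e \in A)) => eA; last by rewrite setU1K ?eqxx ?andbT.
      rewrite andbF; apply/negbTE/negP => /andP[_ /eqP eq].
      by move: eA; rewrite -eq !inE eqxx.
    case/andP => _ /eqP eq.
    have eA : e \notin A by rewrite -eq !inE eqxx.
    by rewrite cardsU1 eA /= exprS setDDl !mulrA.
  by move=> A /andP[_ eA]; rewrite setD1K.
rewrite big_distrr /=; apply: eq_big => [A|A /andP[AV eA]].
  by rewrite subsetD1.
have -> : V :\: A = e |: ((V :\ e) :\: A).
  apply/setP => x; rewrite !inE; case: (x =P e) => [->|] //=; by rewrite eA eV.
rewrite cardsU1 !inE eqxx andbF /= exprS; ring.
Qed.

Lemma expect_set0 p f : expect set0 p f = f set0.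
Proof.
rewrite /expect (big_pred1 set0) => [|A]; last by rewrite subset0.
by rewrite cards0 set0D cards0 !expr0 !mul1r.
Qed.

Lemma eq_expect V p f g :
  (forall A, A \subset V -> f A = g A) -> expect V p f = expect V p g.
Proof. by move=> fg; apply: eq_bigr => A /fg ->. Qed.

Lemma expectD V p f g :
  expect V p (fun A => f A + g A) = expect V p f + expect V p g.
Proof. by rewrite /expect -big_split; apply: eq_bigr => A _; rewrite mulrDr. Qed.

Lemma expectZ V p a f : expect V p (fun A => a * f A) = a * expect V p f.
Proof. by rewrite /expect big_distrr; apply: eq_bigr => A _ /=; ring. Qed.

Lemma expectN V p f : expect V p (fun A => - f A) = - expect V p f.
Proof. by rewrite /expect -sumrN; apply: eq_bigr => A _; rewrite mulrN. Qed.

Lemma expectB V p f g :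
  expect V p (fun A => f A - g A) = expect V p f - expect V p g.
Proof. by rewrite expectD expectN. Qed.

Lemma expect_sum V p (I : finType) (P : pred I) (F : I -> {set T} -> R) :
  expect V p (fun A => \sum_(i | P i) F i A) = \sum_(i | P i) expect V p (F i).
Proof. by rewrite /expect exchange_big /=; apply: eq_bigr => A _; rewrite mulr_sumr. Qed.

Lemma expect_le V p f g : 0 <= p <= 1 ->
  (forall A, A \subset V -> f A <= g A) -> expect V p f <= expect V p g.
Proof.
move=> p01 fg; apply: ler_sum => A /fg; apply: ler_wpM2l.
by apply: mulr_ge0; apply: exprn_ge0; lra.
Qed.


Lemma setU1_ind (P : {set T} -> Prop) :
  P set0 -> (forall e V, e \notin V -> P V -> P (e |: V)) -> forall V, P V.
Proof.
move=> P0 PU V; have [n] := ubnP #|V|; elim: n V => // n IH V.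
case: (set_0Vmem V) => [-> //|[e eV]].
rewrite -(setD1K eV) cardsU1 setD11 ltnS => lt.
by apply: PU; rewrite ?setD11 //; apply: IH.
Qed.

Lemma expect_setU1 e V p f : e \notin V ->
  expect (e |: V) p f = p * expect V p (fun A => f (e |: A))
               + (1 - p) * expect V p f.
Proof. by move=> eV; rewrite (expect_split _ _ (setU11 e V)) setU1K. Qed.

Lemma expect_cst V p a : expect V p (fun _ => a) = a.
Proof.
elim/setU1_ind: V => [|e V eV IH]; first exact: expect_set0.
by rewrite expect_setU1 // IH; ring.
Qed.

Lemma expect_ge0 V p f : 0 <= p <= 1 ->
  (forall A, A \subset V -> 0 <= f A) -> 0 <= expect V p f.
Proof. by move=> p01 f0; rewrite -(expect_cst V p 0); apply: expect_le. Qed.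

Lemma expect_card V p : expect V p (fun A => #|A|%:R) = #|V|%:R * p.
Proof.
elim/setU1_ind: V => [|e V eV IH]; first by rewrite expect_set0 !cards0 mul0r.
rewrite expect_setU1 // (@eq_expect V p (fun A => #|e |: A|%:R) (fun A => 1 + #|A|%:R)).
  by rewrite expectD expect_cst IH cardsU1 eV natrD /=; ring.
move=> A AV; rewrite cardsU1 natrD (_ : e \notin A) //.
by apply: contra eV; apply: (subsetP AV).
Qed.

Definition variance V p f : R := expect V p (fun A => (f A - expect V p f) ^+ 2).

Lemma varianceE V p f :
  variance V p f = expect V p (fun A => f A ^+ 2) - expect V p f ^+ 2.
Proof.
rewrite /variance; set m := expect V p f.
have E A : A \subset V -> (f A - m) ^+ 2 = (f A ^+ 2 + (- (2 * m)) * f A) + m ^+ 2.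
  by move=> _; ring.
by rewrite (eq_expect p E) 2!expectD expectZ expect_cst -/m; ring.
Qed.

(** Efron-Stein inequality.  Exposing one more element [e] adds at most
p(1-p)D^2 to the variance: given the other elements, [f] takes two values that
differ by at most [D]. *)
Lemma variance_le V p f (D : R) : 0 <= p <= 1 ->
  (forall e A, e \notin A -> `|f (e |: A) - f A| <= D) ->
  variance V p f <= #|V|%:R * p * D ^+ 2.
Proof.
move=> p01; elim/setU1_ind: V f => [|e V eV IH] f fD.
  by rewrite varianceE !expect_set0 cards0; lra.
have D0 : 0 <= D.
  by apply: le_trans (fD e set0 _); rewrite ?inE ?normr_ge0.
rewrite varianceE !expect_setU1 //; set f1 := fun A => f (e |: A).
have v0 := IH f fD.
have v1 : variance V p f1 <= #|V|%:R * p * D ^+ 2.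
  (* [f1] is Lipschitz only at sets without [e]; [f2] is so everywhere. *)
  pose f2 A := if e \in A then f A else f (e |: A).
  have -> : variance V p f1 = variance V p f2.
    have E : forall A, A \subset V -> f1 A = f2 A.
      move=> A AV; rewrite /f2 ifN //; apply: contra eV; exact: (subsetP AV).
    by rewrite /variance (eq_expect p E); apply: eq_expect => A AV; rewrite E.
  apply: IH => x A xA; rewrite /f2 !inE.
  case: (x =P e) => [<-|xe].
    by rewrite (negbTE xA) eqxx /= subrr normr0.
  have -> : (e == x) = false by apply/eqP => ex; apply: xe.
  rewrite /=; case: ifP => eA; first exact: fD.
  have -> : e |: (x |: A) = x |: (e |: A) by rewrite setUCA.
  by apply: fD; rewrite !inE negb_or xA andbT; apply/eqP.
have ab : `|expect V p f1 - expect V p f| <= D.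
  rewrite -expectB ler_norml -(expect_cst V p D) -expectN; apply/andP.
  split; apply: expect_le => // A AV; have := fD e A (contra (subsetP AV e) eV);
    by rewrite ler_norml => /andP[].
have ab2 : (expect V p f1 - expect V p f) ^+ 2 <= D ^+ 2.
  by rewrite -real_normK ?num_real // lerXn2r ?nnegrE.
move: v0 v1; rewrite !varianceE cardsU1 eV /= natrD.
set a2 := expect V p (fun A => f1 A ^+ 2); set b2 := expect V p (fun A => f A ^+ 2).
set a := expect V p f1 in ab2 *; set b := expect V p f in ab2 *.
set N := #|V|%:R * p * _ => v0 v1.
have -> : p * a2 + (1 - p) * b2 - (p * a + (1 - p) * b) ^+ 2 =
  p * (a2 - a ^+ 2) + (1 - p) * (b2 - b ^+ 2) + p * (1 - p) * (a - b) ^+ 2 by ring.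
have -> : (1%:R + #|V|%:R) * p * D ^+ 2 = p * N + (1 - p) * N + p * D ^+ 2.
  by rewrite /N; ring.
case/andP: p01 => p0 p1.
apply: lerD; first by apply: lerD; apply: ler_wpM2l => //; lra.
rewrite -mulrA; apply: ler_wpM2l => //.
have : 0 <= (a - b) ^+ 2 by apply: sqr_ge0.
nra.
Qed.

Lemma chebyshev V p f (m t : R) : 0 <= p <= 1 -> 0 < t ->
  m = expect V p f ->
  expect V p (fun A => (t <= `|f A - m|)%R%:R) <= variance V p f / t ^+ 2.
Proof.
move=> p01 t0 ->; rewrite ler_pdivlMr ?exprn_gt0 // mulrC -expectZ.
apply: expect_le => // A _; set x := f A - _.
case: (lerP t `|x|) => tx; last by rewrite mulr0 sqr_ge0.
by rewrite mulr1 -[X in _ <= X]real_normK ?num_real // lerXn2r ?nnegrE // ltW.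
Qed.

(** The presence and the absence of [K] are treated at once, by the sign [b]. *)
Definition force b K A := if b then A :|: K else A :\: K.

(** The density, with respect to the original measure, of the measure
conditioned on [K] being entirely present ([b = true]) or absent. *)
Definition likelihood p b K A : R :=
  \prod_(e in K) (((e \in A) == b)%:R / (if b then p else 1 - p)).

(** Forcing the status of [K] is conditioning on it, because the elements are
independent; one element at a time, this is the split along that element. *)
Lemma expect_force V p b K f : 0 < p < 1 -> K \subset V ->
  expect V p (fun A => f (force b K A)) = expect V p (fun A => f A * likelihood p b K A).
Proof.
move=> p01; elim/setU1_ind: K f => [|e K eK IH] f KV.
  by apply: eq_expect => A _; rewrite /force /likelihood setU0 setD0 big_set0 mulr1; case: b.
move: KV; rewrite subUset sub1set => /andP[eV KV].
have fU A : f (force b (e |: K) A) = f (force b [set e] (force b K A)).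
  by rewrite /force; case: (b); congr f; apply/setP => x; rewrite !inE;
    case: (x \in A) (x == e) (x \in K) => [] [] [].
under eq_expect => A _ do rewrite fU.
rewrite (IH (fun A => f (force b [set e] A))) // !(expect_split _ _ eV) /=.
have likU A : likelihood p b K (e |: A) = likelihood p b K A.
  apply: eq_bigr => x xK; rewrite !inE (_ : (x == e) = false) //.
  by apply: contraNF eK => /eqP <-.
have likU1 A : likelihood p b (e |: K) A = ((e \in A) == b)%:R / (if b then p else 1 - p) * likelihood p b K A.
  by rewrite /likelihood big_setU1.
have sub A : A \subset V :\ e -> e \notin A.
  by rewrite subsetD1 => /andP[].
rewrite -!expectZ -!expectD; apply: eq_expect => A /sub eA.
rewrite !likU1 likU /force !setU11 (negbTE eA).
case: b {IH fU likU likU1} => /=.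
  rewrite setUAC setUid [A :|: _]setUC.
  by field; lra.
rewrite setU1K // [A :\: _](_ : _ = A); last by apply/setDidPl; rewrite disjoint_sym disjoints1.
by field; lra.
Qed.

Lemma expect_likelihood V p b K : 0 < p < 1 -> K \subset V -> expect V p (likelihood p b K) = 1.
Proof.
move=> p01 KV; have := expect_force b (fun=> 1) p01 KV; rewrite expect_cst => ->.
by apply: eq_expect => A _; rewrite mul1r.
Qed.

Lemma likelihood_force p b c K K' A : likelihood p c K' (force b K A) =
  (if b == c then ((if b then p else 1 - p)^-1) ^+ #|K :&: K'|
   else (K :&: K' == set0)%:R) * likelihood p c (K' :\: K) A.
Proof.
rewrite /likelihood (big_setID K) /= [K' :&: K]setIC; congr (_ * _); last first.
  apply: eq_bigr => e; rewrite inE => /andP[eK _].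
  by rewrite /force; case: b; rewrite !inE ?(negbTE eK) ?orbF.
rewrite (eq_bigr (fun=> (b == c)%:R / (if c then p else 1 - p))); last first.
  by move=> e; rewrite inE => /andP[eK _]; rewrite /force; case: b; rewrite !inE eK ?orbT.
rewrite prodr_const; case: (b =P c) => [<-|_]; first by rewrite mul1r.
by rewrite mul0r expr0n cards_eq0.
Qed.

(** Integrating [f] against [tilt p K] measures the effect on [f] of switching
all of [K] on rather than off. *)
Definition tilt p K A : R := likelihood p true K A - likelihood p false K A.

(** The covariance of two tilts, as a function of the number of elements that
they share. *)
Definition tilt_cov p (i : nat) : R := p ^- i + (1 - p) ^- i - 2 * (i == 0%N)%:R.

Lemma tilt_cov0 p : tilt_cov p 0 = 0.
Proof. by rewrite /tilt_cov !expr0 invr1 eqxx mulr1; apply: subrr. Qed.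

Lemma expect_tilt V p K f : 0 < p < 1 -> K \subset V ->
  expect V p (fun A => f A * tilt p K A) =
  expect V p (fun A => f (A :|: K) - f (A :\: K)).
Proof.
move=> p01 KV; rewrite expectB.
have := expect_force true f p01 KV; rewrite /force => ->.
have := expect_force false f p01 KV; rewrite /force => ->.
by rewrite -expectB; apply: eq_expect => A _; rewrite -mulrBr.
Qed.

(** After [K] has been forced, the likelihood of [K'] splits into a constant on
the shared elements and the likelihood of [K' :\: K], which integrates to 1. *)
Lemma expect_tilt_mul V p K K' : 0 < p < 1 -> K \subset V -> K' \subset V ->
  expect V p (fun A => tilt p K A * tilt p K' A) = tilt_cov p #|K :&: K'|.
Proof.
move=> p01 KV KV'; under eq_expect => A _ do rewrite mulrC.
rewrite expect_tilt //.
have K'K : K' :\: K \subset V by apply: subset_trans KV'; apply: subsetDl.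
under eq_expect => A _ do
  rewrite -[_ :|: _]/(force true K A) -[_ :\: _]/(force false K A) /tilt !likelihood_force /=.
rewrite !expectB !expectZ !expect_likelihood // /tilt_cov -cards_eq0 !exprVn; ring.
Qed.

(** The linear part removed here is the one that the derivative in [p] sees. *)
Definition nonlinear_tilt p K A : R := tilt p K A - \sum_(e in K) tilt p [set e] A.

Lemma expect_nonlinear_tilt V p K : 0 < p < 1 -> K \subset V ->
  expect V p (nonlinear_tilt p K) = 0.
Proof.
move=> p01 KV; rewrite /nonlinear_tilt expectB expect_sum.
have tilt0 (L : {set T}) : L \subset V -> expect V p (tilt p L) = 0.
  by move=> LV; rewrite /tilt expectB !expect_likelihood // subrr.
rewrite tilt0 // big1 ?subrr // => e eK; apply: tilt0; rewrite sub1set.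
exact: (subsetP KV).
Qed.

(** Each of the two mixed terms and the product of the linear parts contribute
the same multiple of [tilt_cov p 1].  The result vanishes when at most one
element is shared, which is the reason for removing the linear part. *)
Lemma expect_nonlinear_tilt_mul V p K K' : 0 < p < 1 -> K \subset V -> K' \subset V ->
  expect V p (fun A => nonlinear_tilt p K A * nonlinear_tilt p K' A) =
  tilt_cov p #|K :&: K'| - #|K :&: K'|%:R * tilt_cov p 1.
Proof.
move=> p01 KV KV'.
have sV (L : {set T}) e : L \subset V -> e \in L -> [set e] \subset V.
  by move=> LV eL; rewrite sub1set; apply: (subsetP LV).
have tt1 (L : {set T}) e : L \subset V -> e \in V ->
    expect V p (fun A => tilt p L A * tilt p [set e] A) = (e \in L)%:R * tilt_cov p 1.
  move=> LV eV; rewrite expect_tilt_mul ?sub1set //.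
  case: (boolP (e \in L)) => eL.
    by rewrite (setIidPr _) ?sub1set // cards1 mul1r.
  have -> : L :&: [set e] = set0.
    by apply: disjoint_setI0; rewrite disjoint_sym disjoints1.
  by rewrite cards0 tilt_cov0 mulr0n mul0r.
have Ex (L L' : {set T}) : L \subset V -> L' \subset V ->
    \sum_(e in L) expect V p (fun A => tilt p L' A * tilt p [set e] A) =
    #|L :&: L'|%:R * tilt_cov p 1.
  move=> LV LV'; rewrite (eq_bigr (fun e => (e \in L')%:R * tilt_cov p 1)); last first.
    by move=> e eL; apply: tt1 => //; apply: (subsetP LV).
  rewrite -mulr_suml -natr_sum; congr (_%:R * _).
  rewrite -sum1_card big_mkcond [RHS]big_mkcond /=; apply: eq_bigr => e _.
  by rewrite inE; case: (e \in L) (e \in L') => [] [].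
have -> : expect V p (fun A => nonlinear_tilt p K A * nonlinear_tilt p K' A) =
    expect V p (fun A => tilt p K A * tilt p K' A)
    - \sum_(e in K') expect V p (fun A => tilt p K A * tilt p [set e] A)
    - \sum_(e in K) expect V p (fun A => tilt p K' A * tilt p [set e] A)
    + \sum_(e in K) \sum_(e' in K')
        expect V p (fun A => tilt p [set e] A * tilt p [set e'] A).
  rewrite -!expect_sum.
  under [X in _ = _ + X]eq_bigr => e _ do rewrite -expect_sum.
  rewrite -expect_sum -!expectB -expectD; apply: eq_expect => A _.
  rewrite /nonlinear_tilt -!mulr_sumr.
  under [X in _ = _ + X]eq_bigr => e _ do rewrite -mulr_sumr.
  by rewrite -mulr_suml; ring.
rewrite expect_tilt_mul // !Ex // [K' :&: K]setIC.
rewrite (eq_bigr (fun e => (e \in K')%:R * tilt_cov p 1)); last first.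
  move=> e eK; rewrite Ex ?(sV _ _ KV) //.
  case: (boolP (e \in K')) => eK'.
    by rewrite (setIidPr _) ?sub1set // cards1.
  have -> : K' :&: [set e] = set0.
    by apply: disjoint_setI0; rewrite disjoint_sym disjoints1.
  by rewrite cards0.
rewrite -mulr_suml -natr_sum.
rewrite [\sum_(i in K) _](_ : _ = #|K :&: K'|); first by ring.
rewrite -sum1_card big_mkcond [RHS]big_mkcond /=; apply: eq_bigr => e _.
by rewrite inE; case: (e \in K) (e \in K') => [] [].
Qed.

Lemma nonlinear_tilt_mul_le V p (Pi : R) K K' : 0 < p < 1 -> K \subset V -> K' \subset V ->
  p^-1 <= Pi -> (1 - p)^-1 <= Pi ->
  expect V p (fun A => nonlinear_tilt p K A * nonlinear_tilt p K' A) <=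
  if (#|K :&: K'| <= 1)%N then 0 else 2 * Pi ^+ #|K :&: K'|.
Proof.
move=> p01 KV KV' pP qP; rewrite expect_nonlinear_tilt_mul //.
have g10 : 0 <= tilt_cov p 1.
  rewrite /tilt_cov mulr0 subr0 !expr1.
  by apply: addr_ge0; rewrite invr_ge0; lra.
case: #|_| => [|[|i]].
- by rewrite tilt_cov0 mul0r subr0.
- by rewrite mul1r subrr.
rewrite /=; have -> : tilt_cov p i.+2 = p^-1 ^+ i.+2 + (1-p)^-1 ^+ i.+2.
  by rewrite /tilt_cov mulr0 subr0 !exprVn.
have : 0 <= i.+2%:R * tilt_cov p 1 by rewrite mulr_ge0.
have : p^-1 ^+ i.+2 <= Pi ^+ i.+2 by apply: lerXn2r; rewrite ?nnegrE ?(le_trans _ pP) // invr_ge0; lra.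
have : (1-p)^-1 ^+ i.+2 <= Pi ^+ i.+2 by apply: lerXn2r; rewrite ?nnegrE ?(le_trans _ qP) // invr_ge0; lra.
lra.
Qed.

End RandomSubset.

(** * The derivative in the density *)
Section Russo.
Variables (R : realType) (T : finType).
Implicit Types (V K A : {set T}) (p : R) (f g : {set T} -> R).

(** Margulis-Russo formula.  Conditioning on one element makes the expectation
affine in the density of that element, with slope its expected increment. *)
Lemma is_derive_expect V f p :
  is_derive p 1 (fun q => expect V q f)
    (\sum_(e in V) expect V p (fun A => f (A :|: [set e]) - f (A :\: [set e]))).
Proof.
elim/setU1_ind: V f => [|e V eV IH] f.
  rewrite big_set0 (_ : (fun q => expect _ q f) = cst (f set0)); first exact: is_derive_cst.
  by apply: boolp.funext => q; rewrite expect_set0.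
pose f1 A := f (e |: A).
rewrite (_ : (fun q => _) = (fun q => q * expect V q f1 + (1 - q) * expect V q f)); last first.
  by apply: boolp.funext => q; rewrite expect_setU1.
have d1 := IH f1; have d0 := IH f.
apply: is_derive_eq.
rewrite big_setU1 //= expect_setU1 //.
have -> : expect V p (fun A => f ((e |: A) :|: [set e]) - f ((e |: A) :\: [set e])) =
          expect V p f1 - expect V p f.
  rewrite -expectB; apply: eq_expect => A AV.
  have eA : e \notin A by apply: contra eV; apply: (subsetP AV).
  by rewrite setU1K // /f1 setUAC setUid.
have -> : expect V p (fun A => f (A :|: [set e]) - f (A :\: [set e])) =
          expect V p f1 - expect V p f.
  rewrite -expectB; apply: eq_expect => A AV.
  have eA : e \notin A by apply: contra eV; apply: (subsetP AV).
  by rewrite /f1 setUC [A :\: _](_ : _ = A) //; apply/setDidPl; rewrite disjoint_sym disjoints1.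
have -> : \sum_(i in V) expect (e |: V) p (fun A => f (A :|: [set i]) - f (A :\: [set i])) =
  p * (\sum_(i in V) expect V p (fun A => f1 (A :|: [set i]) - f1 (A :\: [set i])))
  + (1 - p) * (\sum_(i in V) expect V p (fun A => f (A :|: [set i]) - f (A :\: [set i]))).
  rewrite !mulr_sumr -big_split; apply: eq_bigr => i iV /=.
  rewrite expect_setU1 //; congr (_ * _ + _); apply: eq_expect => A _.
  rewrite /f1 setUA; congr (_ - f _); apply/setP => x; rewrite !inE.
  case: (x =P i) => //= ->; rewrite (_ : (i == e) = false) //.
  by apply: contraNF eV => /eqP <-.
by rewrite /GRing.scale /=; ring.
Qed.

End Russo.

(** * Partitions into blocks of a given family *)
Section BlockPartition.
Variables (T : finType) (B : {set {set T}}).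
Hypothesis single : forall x, [set x] \in B.
Implicit Types (A K : {set T}) (P : {set {set T}}).

Definition block_partition P A := partition P A && (P \subset B).

Definition block_number A : nat :=
  #|[arg min_(P < [set [set x] | x in A] | block_partition P A) #|P| ]|.

Lemma block_partition_singletons A : block_partition [set [set x] | x in A] A.
Proof.
apply/andP; split; last by apply/subsetP => K /imsetP[x _ ->].
apply/and3P; split.
- apply/eqP/setP => x; rewrite /cover; apply/bigcupP/idP => [[K /imsetP[y yA ->]]|xA].
    by rewrite inE => /eqP ->.
  by exists [set x]; rewrite ?set11 //; apply/imsetP; exists x.
- apply/trivIsetP => K L /imsetP[x _ ->] /imsetP[y _ ->] xy.
  by rewrite disjoints1 inE; apply: contra xy => /eqP ->.
- by apply/imsetP => -[x _ /setP/(_ x)]; rewrite !inE eqxx.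
Qed.

Lemma block_numberP A : exists2 P, block_partition P A & block_number A = #|P|.
Proof.
rewrite /block_number; case: arg_minnP; first exact: block_partition_singletons.
by move=> P bP _; exists P.
Qed.

Lemma block_number_min P A : block_partition P A -> (block_number A <= #|P|)%N.
Proof.
rewrite /block_number; case: arg_minnP; first exact: block_partition_singletons.
by move=> Q bQ Qmin /Qmin.
Qed.

Lemma block_number_card A : (block_number A <= #|A|)%N.
Proof.
apply: leq_trans (block_number_min (block_partition_singletons A)) _.
exact: leq_imset_card.
Qed.

(** A block disjoint from a partitioned set is a single additional class. *)
Lemma block_number_setU K A : K \in B ->
  (block_number (A :|: K) <= (block_number (A :\: K)).+1)%N.
Proof.
move=> KB; case: (set_0Vmem K) => [->|[x xK]]; first by rewrite setU0 setD0.
have [P /andP[/and3P[/eqP cP tP P0] PB] ->] := block_numberP (A :\: K).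
have [] := @trivIsetU1 _ K P _ tP P0.
  move=> L LP; rewrite disjoint_sym; apply: disjointWl (_ : L \subset A :\: K) _.
    by rewrite -cP; apply: bigcup_sup.
  by rewrite -setI_eq0 setIDAC -setIDA setDv setI0.
move=> tKP KP; have := @block_number_min (K |: P) (A :|: K).
rewrite cardsU1 KP; apply; apply/andP; split; last by rewrite subUset sub1set KB.
apply/and3P; split=> //.
  by rewrite /cover bigcup_setU big_set1 -/(cover P) cP; apply/eqP/setP => y; rewrite !inE; case: (y \in A) (y \in K) => [] [].
rewrite !inE negb_or P0 andbT; apply/eqP => K0; by rewrite -K0 inE in xK.
Qed.

Lemma block_number_setU1 x A : (block_number (x |: A) <= (block_number A).+1)%N.
Proof.
case: (boolP (x \in A)) => xA; first by rewrite (setUidPr _) ?sub1set.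
have := block_number_setU A (single x); rewrite setUC (_ : A :\: _ = A) //.
by apply/setDidPl; rewrite disjoint_sym disjoints1.
Qed.

Lemma block_number_setU_card A K : (block_number (K :|: A) <= block_number A + #|K|)%N.
Proof.
elim/setU1_ind: K => [|x K xK IH]; first by rewrite set0U cards0 addn0.
rewrite -setUA cardsU1 xK; apply: leq_trans (block_number_setU1 _ _) _.
by rewrite addnCA add1n ltnS.
Qed.

(** Removing [x] destroys one block, whose other elements become singletons. *)
Lemma block_number_setD1 (D : nat) x A : (forall K, K \in B -> #|K| <= D)%N ->
  x \notin A -> (block_number A <= block_number (x |: A) + D)%N.
Proof.
move=> BD xA; have [P /andP[pP PB] ->] := block_numberP (x |: A).
have [/eqP cP tP _] := and3P pP.
have xP : x \in cover P by rewrite cP setU11.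
have KP : pblock P x \in P by rewrite pblock_mem.
have xK : x \in pblock P x by rewrite mem_pblock.
set K := pblock P x in KP xK.
have pD := partitionD1 pP KP.
have bD : block_partition (P :\ K) (A :\: K).
  rewrite /block_partition (subset_trans (subsetDl _ _) PB) andbT.
  rewrite (_ : A :\: K = (x |: A) :\: K) //.
  by apply/setP => y; rewrite !inE; case: (y =P x) => [->|//]; rewrite xK.
have := block_number_setU_card (A :\: K) (A :&: K); rewrite setID => le.
apply: leq_trans le _; apply: leq_add.
  by apply: leq_trans (block_number_min bD) _; rewrite (cardsD1 K P) KP leq_addl.
apply: leq_trans (BD K _); last exact: (subsetP PB).
by apply: subset_leq_card; apply: subsetIr.
Qed.

End BlockPartition.

(** * Cliques and counting *)
Section Binomials.

(** The probability that a random [s]-subset contains [j] given points is at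
most [(s / n) ^ j], stated without division. *)
Lemma bin_sub_le n s j : (j <= s)%N -> (s <= n)%N ->
  ('C(n - j, s - j) * n ^ j <= s ^ j * 'C(n, s))%N.
Proof.
elim: j => [|j IH] js sn; first by rewrite !subn0 !expn0 muln1 mul1n.
have {IH} := IH (ltnW js) sn.
have nj : (0 < n - j)%N by rewrite subn_gt0 (leq_trans js).
have := mul_bin_diag (n - j) (s - j.+1).
rewrite -subnS -(subnSK js); set c := 'C(_, _); set d := 'C(_, _.+1) => E le.
rewrite -(leq_pmul2l nj) !expnS.
have nbsa : (n * (s - j.+1).+1 <= s * (n - j))%N.
  by rewrite subnSK // !mulnBr [(s * n)%N]mulnC leq_sub2l // leq_mul2r sn orbT.
have h1 := leq_mul (leqnn (n * (s - j.+1).+1)) le.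
have h2 := leq_mul nbsa (leqnn (s ^ j * 'C(n, s))).
have h3 : ((n - j) * c * (n * n ^ j) = (s - j.+1).+1 * d * (n * n ^ j))%N by rewrite E.
apply: leq_trans (leq_trans _ h2) _; last by rewrite !mulnA leq_mul2r [(s * _)%N]mulnC leqnn orbT.
by apply: leq_trans h1; rewrite mulnA h3; apply: eq_leq; ring.
Qed.

Lemma bin_le_exp n j : ('C(n, j) <= n ^ j)%N.
Proof.
elim: j n => [|j IH] [|n]; rewrite ?bin0 ?expn0 // ?bin0n //.
apply: (@leq_trans (j.+1 * 'C(n.+1, j.+1))%N); first by rewrite leq_pmull.
rewrite -mul_bin_diag expnS leq_mul2l; apply/orP; right.
by apply: leq_trans (IH n) _; case: (j) => // k; rewrite leq_exp2r.
Qed.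

End Binomials.

Section Cliques.
Variable (U : finType).
Implicit Types (Q J : {set U}) (G : sgraph U).

Definition pairs_in Q : {set {set U}} := [set e in vpairs U | e \subset Q].

Lemma pairs_in_vpairs Q : pairs_in Q \subset vpairs U.
Proof. by apply/subsetP => e; rewrite inE => /andP[]. Qed.

Lemma card_pairs_in Q : #|pairs_in Q| = 'C(#|Q|, 2).
Proof. by rewrite -cards_draws; apply: eq_card => e; rewrite !inE andbC. Qed.

Lemma pairs_inI Q J : pairs_in Q :&: pairs_in J = pairs_in (Q :&: J).
Proof.
by apply/setP => e; rewrite !inE subsetI; case: (#|e| == 2) => //=.
Qed.

Lemma cover_pairs_in Q : (1 < #|Q|)%N -> cover (pairs_in Q) = Q.
Proof.
move=> Q2; apply/setP => x; apply/bigcupP/idP => [[e]|xQ].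
  by rewrite inE => /andP[_ /subsetP eQ] /eQ.
have: (0 < #|Q :\ x|)%N by move: Q2; rewrite (cardsD1 x Q) xQ.
case/card_gt0P => y; rewrite !inE => /andP[yx yQ].
exists [set x; y]; last by rewrite !inE eqxx.
by rewrite !inE cards2 [x == y]eq_sym yx subUset !sub1set xQ.
Qed.

Lemma cliqueE G Q : clique G Q = (pairs_in Q \subset edges G).
Proof.
apply/forall_inP/subsetP => [cQ e|sQ x xQ].
  rewrite !inE => /andP[/cards2P[x [y [xy ->]]]].
  rewrite subUset !sub1set => /andP[xQ yQ].
  by have /forall_inP/(_ _ yQ)/implyP := cQ _ xQ; apply.
apply/forall_inP => y yQ; apply/implyP => xy; apply: sQ.
by rewrite !inE cards2 xy subUset !sub1set xQ.
Qed.

Lemma card_supersets J s : (#|J| <= s)%N ->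
  #|[set Q : {set U} | (J \subset Q) && (#|Q| == s)]| = 'C(#|U| - #|J|, s - #|J|).
Proof.
move=> Js; rewrite -[#|U|](cardsC J) addKn -cards_draws.
rewrite -(card_in_imset (f := fun Q => Q :\: J)).
  apply: eq_card => L; rewrite !inE; apply/imsetP/andP => [[Q]|[LJ /eqP cL]].
    rewrite inE => /andP[JQ /eqP cQ] ->; rewrite cardsD (setIidPr JQ) cQ eqxx.
    by split=> //; rewrite setDE subsetIr.
  have JL : [disjoint L & J].
    by rewrite disjoints_subset.
  exists (L :|: J); last first.
    by rewrite setDUl setDv setU0 (setDidPl _).
  by rewrite inE subsetUr cardsU (disjoint_setI0 JL) cards0 subn0 cL subnK ?eqxx.
move=> Q Q'; rewrite !inE => /andP[JQ _] /andP[JQ' _].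
move=> /= E.
have -> : Q = J :|: (Q :\: J) by rewrite -{1}(setIidPr JQ) setID.
by rewrite E -{1}(setIidPr JQ') setID.
Qed.

(** The size of the cliques is capped so that the block number is Lipschitz.
Singletons are included so that every set, even one with elements that are not
pairs of vertices, has a partition. *)
Definition clique_blocks (S : nat) : {set {set {set U}}} :=
  [set [set e] | e : {set U}] :|: [set pairs_in Q | Q : {set U} & (#|Q| <= S)%N].

Lemma clique_blocks_single S e : [set e] \in clique_blocks S.
Proof. by rewrite inE imset_f. Qed.

Lemma clique_blocks_pairs S Q : (#|Q| <= S)%N -> pairs_in Q \in clique_blocks S.
Proof. by move=> QS; rewrite inE orbC imset_f ?inE. Qed.

Lemma card_clique_blocks S K : (1 < S)%N -> K \in clique_blocks S -> (#|K| <= S ^ 2)%N.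
Proof.
move=> S2; rewrite inE => /orP[/imsetP[e _ ->]|/imsetP[Q]].
  by rewrite cards1 expn_gt0 (ltnW S2).
rewrite inE => QS ->; rewrite card_pairs_in; apply: leq_trans (bin_le_exp _ _) _.
by rewrite leq_exp2r.
Qed.

(** A block of pairs determines its vertex set, the union of these pairs; the
vertex sets of the blocks of a partition of the edges form a clique partition. *)
Lemma cp_le_block_number G S : (cp G <= block_number (clique_blocks S) (edges G))%N.
Proof.
have [P /andP[pP PB] ->] := block_numberP (clique_blocks_single S) (edges G).
have [/eqP cP tP P0] := and3P pP.
have KG K : K \in P -> K \subset edges G by move=> KP; rewrite -cP; apply: bigcup_sup.
(* This covers singletons as well: a single edge is the pair set of its ends. *)
have block K : K \in P -> pairs_in (cover K) = K.
  move=> KP; have K0 : K != set0 by apply: contraNneq P0 => <-.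
  move/(subsetP PB): (KP); rewrite inE => /orP[/imsetP[e _ Ke]|/imsetP[Q _ KQ]].
    have : e \in vpairs U.
      by apply/(subsetP (edges_vpairs G))/(subsetP (KG _ KP)); rewrite Ke set11.
    rewrite inE => e2; rewrite Ke /cover big_set1; apply/setP => f; rewrite !inE.
    apply/andP/eqP => [[/eqP f2 fe]|->]; last by rewrite e2.
    by apply/eqP; rewrite eqEcard fe f2 (eqP e2).
  rewrite KQ cover_pairs_in //; move: K0; rewrite -card_gt0 KQ card_pairs_in.
  by rewrite bin_gt0.
pose F := [set cover K | K in P].
have FP : (#|F| <= #|P|)%N by apply: leq_imset_card.
suff cF : clique_partition G F.
  rewrite /cp; case: ex_minnP => m _ /(_ #|F|); move=> /(_ _)/leq_trans; apply=> //.
  by apply/existsP; exists F; rewrite cF eqxx.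
apply/andP; split.
  by apply/forall_inP => Q /imsetP[K KP ->]; rewrite cliqueE block ?KG.
apply/forall_inP => e eG; apply/cards1P.
have eV := subsetP (edges_vpairs G) _ eG.
have eP : e \in cover P by rewrite cP.
have sub K : K \in P -> (e \subset cover K) = (e \in K).
  by move=> KP; rewrite -[in RHS](block _ KP) inE eV.
exists (cover (pblock P e)); apply/setP => Q; rewrite !inE; apply/andP/eqP.
  case=> /imsetP[K KP ->]; rewrite sub // => eK.
  by rewrite (def_pblock tP KP eK).
by move=> ->; rewrite imset_f ?pblock_mem // sub ?mem_pblock ?pblock_mem.
Qed.

Lemma cc_le_cp G : (cc G <= cp G)%N.
Proof.
rewrite /cp; case: ex_minnP => m /existsP[F /andP[cF /eqP <-]] _.
rewrite /cc; case: ex_minnP => k _; apply; apply/existsP; exists F.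
by rewrite clique_partition_covering // eqxx.
Qed.

Lemma card_edges_le_cc G (k : nat) :
  (forall Q, clique G Q -> (#|Q| <= k)%N) -> (#|edges G| <= cc G * 'C(k, 2))%N.
Proof.
move=> ck; rewrite /cc; case: ex_minnP => m /existsP[F /andP[/andP[/forall_inP cF /forall_inP covF] /eqP <-]] _.
have : edges G \subset \bigcup_(Q in F) pairs_in Q.
  apply/subsetP => e eG; have /exists_inP[Q QF eQ] := covF e eG.
  by apply/bigcupP; exists Q; rewrite // inE eQ (subsetP (edges_vpairs G)).
move/subset_leq_card/leq_trans; apply.
apply: (@leq_trans (\sum_(Q in F) #|pairs_in Q|)%N).
  elim/big_rec2: _ => [|Q m' A _ le]; first by rewrite cards0.
  by rewrite cardsU (leq_trans (leq_subr _ _)) // leq_add2l.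
rewrite -sum_nat_const; apply: leq_sum => Q QF.
by rewrite card_pairs_in leq_bin2l // ck // cF.
Qed.

End Cliques.

(** * The differential inequality *)
Section DerivativeBound.
Variables (R : realType) (U : finType) (p Pi : R).
Let n := #|U|.
Let V := vpairs U.
Hypothesis p01 : 0 < p < 1.
Hypothesis pPi : p^-1 <= Pi.
Hypothesis qPi : (1 - p)^-1 <= Pi.
Implicit Types (Q J : {set U}) (A : {set {set U}}).

Let Pi1 : 1 <= Pi.
Proof.
by case/andP: p01 => p0 /ltW p1; apply: le_trans pPi; rewrite invf_ge1.
Qed.

Let p01w : 0 <= p <= 1.
Proof. by case/andP: p01 => /ltW -> /ltW ->. Qed.

Definition nonlinear_sum s A : R := \sum_(Q : {set U} | #|Q| == s) nonlinear_tilt p (pairs_in Q) A.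

Lemma sum_supersets s J : (#|J| <= s)%N -> (s <= n)%N ->
  \sum_(Q : {set U} | #|Q| == s) (J \subset Q)%:R <= 'C(n, s)%:R * (s%:R / n%:R) ^+ #|J| :> R.
Proof.
move=> Js sn; rewrite -natr_sum -big_mkcondr sum1dep_card.
rewrite (_ : [set _ | _] = [set Q : {set U} | (J \subset Q) && (#|Q| == s)]); last first.
  by apply/setP => Q; rewrite !inE andbC.
rewrite card_supersets //; case: (posnP n) => [n0|n0].
  have J0 : #|J| = 0%N by apply/eqP; rewrite -leqn0 (leq_trans Js) // -n0.
  by rewrite J0 !subn0 expr0 mulr1.
rewrite expr_div_n mulrA ler_pdivlMr ?exprn_gt0 ?ltr0n // -!natrX -!natrM ler_nat.
by rewrite [('C(n, s) * _)%N]mulnC bin_sub_le.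
Qed.

(** Only pairs [Q], [Q'] with at least three common vertices contribute.  A
given set [J] of [j] vertices lies in both with probability at most
(s/n)^(2j), there are at most n^j such sets, and the correlation is at most
2 Pi^binom(j,2) <= 2 (Pi^s)^j; hence the sum of the z^j over 3 <= j <= s. *)
Lemma nonlinear_sum_sq_le s (z : R) : z = Pi ^+ s * s%:R ^+ 2 / n%:R ->
  (s <= n)%N -> z <= 1 ->
  expect V p (fun A => nonlinear_sum s A ^+ 2) <= 2 * 'C(n, s)%:R ^+ 2 * (s%:R * z ^+ 3).
Proof.
move=> zE sn z1; have Pi0 : 0 <= Pi by apply: le_trans Pi1.
set M : R := 'C(n, s)%:R.
have z0 : 0 <= z by rewrite zE divr_ge0 // mulr_ge0 ?exprn_ge0.
pose good J := (2 < #|J| <= s)%N.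
pose y J : R := 2 * (Pi ^+ s) ^+ #|J|.
have y0 J : 0 <= y J by rewrite /y mulr_ge0 // !exprn_ge0.
have t0 Q Q' J : 0 <= (J \subset Q)%:R * (J \subset Q')%:R * y J.
  by apply: mulr_ge0 (y0 J); apply: mulr_ge0; apply: ler0n.
(* The contribution of a pair is charged to [J = Q :&: Q']. *)
have term Q Q' : #|Q| == s -> #|Q'| == s ->
    expect V p (fun A => nonlinear_tilt p (pairs_in Q) A * nonlinear_tilt p (pairs_in Q') A) <=
    \sum_(J | good J) (J \subset Q)%:R * (J \subset Q')%:R * y J.
  move=> /eqP cQ _.
  apply: le_trans (nonlinear_tilt_mul_le p01 (pairs_in_vpairs Q) (pairs_in_vpairs Q') pPi qPi) _.
  rewrite pairs_inI card_pairs_in; set J := Q :&: Q'.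
  have Js : (#|J| <= s)%N by rewrite -cQ subset_leq_card // subsetIl.
  case: ifP => [_|/negbT]; first by apply: sumr_ge0.
  rewrite -ltnNge => J2.
  have J3 : (2 < #|J|)%N by move: J2; case: #|J| => [|[|[|k]]].
  rewrite (bigD1 J) /=; last by rewrite /good J3 Js.
  rewrite subsetIl subsetIr !mul1r; apply: le_trans (_ : y J <= _); last first.
    by rewrite lerDl; apply: sumr_ge0.
  rewrite /y -exprM ler_pM2l //; apply: ler_weXn2l => //.
  rewrite bin2 -divn2 (leq_trans (leq_div _ _)) // mulnC leq_mul //.
  by apply: leq_trans Js; apply: leq_pred.
have -> : expect V p (fun A => nonlinear_sum s A ^+ 2) =
   \sum_(Q : {set U} | #|Q| == s) \sum_(Q' : {set U} | #|Q'| == s)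
     expect V p (fun A => nonlinear_tilt p (pairs_in Q) A * nonlinear_tilt p (pairs_in Q') A).
  under eq_bigr => Q _ do rewrite -expect_sum.
  rewrite -expect_sum; apply: eq_expect => A _.
  rewrite expr2 {1}/nonlinear_sum mulr_suml; apply: eq_bigr => Q _.
  by rewrite mulr_sumr.
apply: le_trans (_ : \sum_(J | good J) (\sum_(Q : {set U} | #|Q| == s) (J \subset Q)%:R) ^+ 2 * y J <= _).
  under [X in _ <= X]eq_bigr => J _ do rewrite expr2 !mulr_suml.
  rewrite [X in _ <= X]exchange_big; apply: ler_sum => Q sQ /=.
  under [X in _ <= X]eq_bigr => J _ do rewrite mulr_sumr mulr_suml.
  by rewrite [X in _ <= X]exchange_big; apply: ler_sum => Q' sQ' /=; apply: term.
apply: le_trans (_ : \sum_(J | good J) 2 * M ^+ 2 * (z / n%:R) ^+ #|J| <= _).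
  apply: ler_sum => J /andP[_ Js].
  have sub := sum_supersets Js sn.
  have s0 : 0 <= \sum_(Q : {set U} | #|Q| == s) (J \subset Q)%:R :> R by apply: sumr_ge0.
  have -> : 2 * M ^+ 2 * (z / n%:R) ^+ #|J| = (M * (s%:R / n%:R) ^+ #|J|) ^+ 2 * y J.
    rewrite (_ : z / n%:R = Pi ^+ s * (s%:R / n%:R) ^+ 2); last by rewrite zE expr_div_n expr2 invfM !mulrA.
    rewrite /y [in LHS]exprMn [((s%:R / _) ^+ 2) ^+ _]exprAC; ring.
  have r0 : 0 <= M * (s%:R / n%:R) ^+ #|J| by rewrite mulr_ge0 ?exprn_ge0 ?divr_ge0 ?ler0n.
  by apply: ler_wpM2r (y0 J) _ _ _; apply: lerXn2r; rewrite ?nnegrE.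
rewrite -mulr_sumr; apply: ler_wpM2l; first by rewrite mulr_ge0 ?exprn_ge0.
rewrite (partition_big (fun J : {set U} => inord #|J| : 'I_s.+1) (fun j : 'I_s.+1 => 2 < j)%N) /=; last first.
  by move=> J /andP[J2 Js]; rewrite inordK.
have z3 (j : 'I_s.+1) : (2 < j)%N ->
    \sum_(J | good J && (inord #|J| == j)) (z / n%:R) ^+ #|J| <= z ^+ 3.
  move=> j2; apply: le_trans (_ : \sum_(J : {set U} | #|J| == j) (z / n%:R) ^+ j <= _).
    rewrite (eq_bigl (fun J : {set U} => good J && (#|J| == j))); last first.
      move=> J; rewrite /good; case: (ltnP 2 #|J|) => //= _; case: (leqP #|J| s) => //= Js.
      by rewrite -val_eqE /= inordK.
    rewrite big_mkcond [X in _ <= X]big_mkcond; apply: ler_sum => J _.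
    case: eqP => [->|_]; last by rewrite andbF.
    by rewrite andbT; case: ifP => // _; apply: exprn_ge0 (divr_ge0 z0 (ler0n _ _)).
  have n0 : 0 < n%:R ^+ j :> R.
    rewrite exprn_gt0 // ltr0n; apply: leq_trans sn.
    by move: (ltn_ord j); rewrite ltnS; apply: leq_trans; apply: leq_trans j2.
  rewrite sumr_const -cardsE card_draws -/n -[_ *+ _]mulr_natl expr_div_n mulrCA.
  apply: le_trans (_ : z ^+ j <= _); last by rewrite ler_wiXn2l.
  rewrite -[X in _ <= X]mulr1 ler_wpM2l ?exprn_ge0 // ler_pdivrMr // mul1r -natrX ler_nat.
  exact: bin_le_exp.
apply: le_trans (_ : \sum_(j < s.+1 | (2 < j)%N) z ^+ 3 <= _); first exact: ler_sum.
rewrite big_mkcond big_ord_recl /= add0r.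
apply: le_trans (_ : \sum_(j < s) z ^+ 3 <= _).
  by apply: ler_sum => j _; case: ifP => // _; rewrite exprn_ge0.
rewrite sumr_const card_ord mulr_natl. done.
Qed.

Section BlockNumber.
Variable S : nat.
Hypothesis S2 : (1 < S)%N.

Definition block_cost A : R := (block_number (clique_blocks U S) A)%:R.

Let F := expect V p block_cost.

(** The derivative of the expected [block_cost] at [p], by
[is_derive_expect]. *)
Definition block_slope : R :=
  \sum_(e in V) expect V p (fun A => block_cost (A :|: [set e]) - block_cost (A :\: [set e])).

Lemma block_cost_lipschitz e A : e \notin A ->
  `|block_cost (e |: A) - block_cost A| <= (S ^ 2)%:R.
Proof.
move=> eA; have S0 : (0 < S ^ 2)%N by rewrite expn_gt0 ltnW.
have up := block_number_setU1 (clique_blocks_single S) e A.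
have dn := block_number_setD1 (clique_blocks_single S)
  (fun K => @card_clique_blocks _ S K S2) eA.
move: up dn S0; rewrite /block_cost -!(ler_nat R) -addn1 !natrD ler_norml.
by move=> up dn S0; apply/andP; split; lra.
Qed.

Lemma block_cost_setU K A : K \in clique_blocks U S ->
  block_cost (A :|: K) - block_cost (A :\: K) <= 1.
Proof.
move=> KB; rewrite lerBlDr /block_cost nat1r ler_nat.
by apply: block_number_setU => //; apply: clique_blocks_single.
Qed.

Lemma block_slope_le_card : block_slope <= #|V|%:R.
Proof.
rewrite -sum1_card natr_sum; apply: ler_sum => e _.
rewrite -[X in _ <= X](expect_cst V p); apply: expect_le => //.
by move=> A _; apply: block_cost_setU; apply: clique_blocks_single.
Qed.

Lemma variance_block_cost :
  variance V p block_cost <= n%:R ^+ 2 * p * S%:R ^+ 4.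
Proof.
apply: le_trans (variance_le _ p01w block_cost_lipschitz) _.
rewrite natrX -exprM; apply: ler_wpM2r; first by rewrite exprn_ge0.
apply: ler_wpM2r; first by case/andP: p01w.
by rewrite card_draws -natrX ler_nat bin_le_exp.
Qed.

Lemma sum_tilt_block_cost s : (s <= S)%N ->
  \sum_(Q : {set U} | #|Q| == s) expect V p (fun A => block_cost A * tilt p (pairs_in Q) A)
  <= 'C(n, s)%:R.
Proof.
move=> sS; rewrite -card_draws -sum1_card natr_sum.
rewrite [X in _ <= X](eq_bigl (fun Q : {set U} => #|Q| == s)); last by move=> Q; rewrite inE.
apply: ler_sum => Q /eqP cQ; rewrite expect_tilt ?pairs_in_vpairs //.
rewrite -[X in _ <= X](expect_cst V p); apply: expect_le => //.
by move=> A _; apply: block_cost_setU; apply: clique_blocks_pairs; rewrite cQ.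
Qed.

(** Each pair of vertices lies in the same number of [s]-sets, so the linear
parts add up to a multiple of the derivative of the expectation. *)
Lemma expect_nonlinear_sum s (f : {set {set U}} -> R) : (1 < s)%N ->
  expect V p (fun A => f A * nonlinear_sum s A) =
  \sum_(Q : {set U} | #|Q| == s) expect V p (fun A => f A * tilt p (pairs_in Q) A)
  - 'C(n - 2, s - 2)%:R * \sum_(e in V) expect V p (fun A => f (A :|: [set e]) - f (A :\: [set e])).
Proof.
move=> s2; have -> : 'C(n - 2, s - 2)%:R * \sum_(e in V) expect V p (fun A => f (A :|: [set e]) - f (A :\: [set e]))
   = \sum_(Q : {set U} | #|Q| == s) \sum_(e in pairs_in Q) expect V p (fun A => f A * tilt p [set e] A).
  rewrite (exchange_big_dep (mem V)) /=; last first.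
    by move=> Q e _ /(subsetP (pairs_in_vpairs Q)).
  rewrite mulr_sumr; apply: eq_bigr => e eV; rewrite -expect_tilt ?sub1set //.
  rewrite sumr_const -[RHS]mulr_natl; congr (_%:R * _).
  have e2 : #|e| = 2%N by move: eV; rewrite inE => /eqP.
  rewrite -[X in 'C(_ - X, _ - X)]e2 -card_supersets ?e2 //.
  by apply: eq_card => Q; rewrite !inE unfold_in /= !inE e2 eqxx andbC.
rewrite -sumrB.
under [RHS]eq_bigr => Q _ do rewrite -expect_sum -expectB.
rewrite -expect_sum; apply: eq_expect => A _.
rewrite mulr_sumr; apply: eq_bigr => Q _.
by rewrite /nonlinear_tilt mulrBr mulr_sumr.
Qed.

(** The increment inequality, summed over all cliques on [s] vertices, bounds
the slope up to the covariance of the cost with [nonlinear_sum].  The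
condition relating [S], [Pi] and [s] to the order of the graph is what makes
this covariance at most the main term. *)
Lemma block_slope_le s : (1 < s <= S)%N -> (s <= n)%N ->
  2 * S%:R ^+ 11 * Pi ^+ (3 * s) <= n%:R ->
  s%:R * (s%:R - 1) * block_slope <= 2 * n%:R ^+ 2.
Proof.
move=> /andP[s2 sS] sn cond.
have Pi0 : 0 < Pi by apply: lt_le_trans Pi1.
have n0 : 0 < n%:R :> R by rewrite ltr0n (leq_trans _ sn) // ltnW.
have Sr0 : 0 < S%:R :> R by rewrite ltr0n ltnW.
have Sr1 : 1 <= S%:R :> R by rewrite ler1n ltnW.
have sr0 : 0 < s%:R :> R by rewrite ltr0n ltnW.
have srS : s%:R <= S%:R :> R by rewrite ler_nat.
set M : R := 'C(n, s)%:R; have M0 : 0 < M by rewrite ltr0n bin_gt0.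
set z := Pi ^+ s * s%:R ^+ 2 / n%:R.
have z1 : z <= 1.
  rewrite ler_pdivrMr // mul1r; apply: le_trans cond.
  apply: le_trans (_ : Pi ^+ (3 * s) * S%:R ^+ 11 <= _); last first.
    rewrite mulrC -mulrA ler_peMl ?mulr_ge0 ?exprn_ge0 ?ler1n // ltW //.
  apply: ler_pM; rewrite ?exprn_ge0 ?(ltW Pi0) ?(ltW sr0) //.
    by apply: ler_weXn2l => //; rewrite leq_pmull.
  apply: le_trans (_ : S%:R ^+ 2 <= _); last exact: ler_weXn2l.
  by apply: lerXn2r; rewrite ?nnegrE // ltW.
pose a : R := n%:R ^+ 2 * S%:R ^+ 4; have a0 : 0 < a by rewrite mulr_gt0 ?exprn_gt0.
(* [a] bounds the variance of the cost, so this compares both second moments. *)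
have saz : 2 * (s%:R * z ^+ 3) * a <= 1.
  have -> : 2 * (s%:R * z ^+ 3) * a = 2 * (s%:R ^+ 7 * S%:R ^+ 4) * Pi ^+ (3 * s) / n%:R.
    rewrite /z /a mulnC exprM; field; lra.
  rewrite ler_pdivrMr // mul1r; apply: le_trans cond.
  apply: ler_wpM2r; first by rewrite exprn_ge0 // ltW.
  rewrite ler_pM2l // (exprD _ 7 4); apply: ler_wpM2r; first by rewrite exprn_ge0 // ltW.
  by apply: lerXn2r; rewrite ?nnegrE // ltW.
have sq := nonlinear_sum_sq_le (erefl z) sn z1; rewrite -/M in sq.
have E0 : expect V p (nonlinear_sum s) = 0.
  by rewrite expect_sum big1 // => Q _; apply: expect_nonlinear_tilt; rewrite ?pairs_in_vpairs.
set X := nonlinear_sum s in sq E0 *.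
(* Cauchy-Schwarz, in the form of a square with the optimal weight [tau]. *)
have key : - expect V p (fun A => block_cost A * X A) <= M.
  (* Naming the mean keeps it from being merged into the expectations. *)
  have [m mE] : exists m, m = F by exists F.
  pose tau := M / a; have tau0 : 0 < tau by rewrite divr_gt0.
  have : 0 <= expect V p (fun A => (tau * (block_cost A - m) + X A) ^+ 2).
    by apply: expect_ge0 => // A _; exact: sqr_ge0.
  have -> : expect V p (fun A => (tau * (block_cost A - m) + X A) ^+ 2) =
     tau ^+ 2 * variance V p block_cost + 2 * tau * expect V p (fun A => block_cost A * X A)
     + expect V p (fun A => X A ^+ 2).
    have -> : 2 * tau * expect V p (fun A => block_cost A * X A) =
      2 * tau * expect V p (fun A => block_cost A * X A) - 2 * tau * m * expect V p X.
      by rewrite E0; ring.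
    rewrite /variance -!expectZ -expectB -!expectD; apply: eq_expect => A _.
    by rewrite -/F -mE; ring.
  set Y := expect V p (fun A => block_cost A * X A); move=> pos.
  have v : tau ^+ 2 * variance V p block_cost <= tau * M.
    apply: le_trans (_ : tau ^+ 2 * a <= _).
      apply: ler_wpM2l; first by rewrite sqr_ge0.
      apply: le_trans variance_block_cost _; rewrite /a ler_wpM2r ?exprn_ge0 ?ler0n //.
      by rewrite ler_piMr ?exprn_ge0 //; case/andP: p01w.
    by rewrite expr2 -mulrA ler_pM2l // /tau divfK // gt_eqF.
  have w : expect V p (fun A => X A ^+ 2) <= tau * M.
    apply: le_trans sq _.
    rewrite (_ : 2 * M ^+ 2 * _ = tau * M * (2 * (s%:R * z ^+ 3) * a)); last first.
      by rewrite /tau; field; lra.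
    by rewrite ler_piMr // ltW // mulr_gt0.
  rewrite -(ler_pM2l tau0); lra.
have slope : 'C(n - 2, s - 2)%:R * block_slope <= 2 * M.
  have := expect_nonlinear_sum block_cost s2; rewrite -/X -/block_slope => E.
  have := sum_tilt_block_cost sS; rewrite -/M; lra.
have binE : n%:R * (n%:R - 1) * 'C(n - 2, s - 2)%:R = s%:R * (s%:R - 1) * M.
  have n2 := leq_trans s2 sn.
  rewrite -(natrB _ (ltnW n2)) -(natrB _ (ltnW s2)) -!natrM; congr _%:R.
  move: s2 n2; case: (s) => [|[|t]] // _; case: (n) => [|[|m]] // _.
  rewrite !subn2 !subn1 /= -mulnA (mul_bin_diag m.+1 t) mulnCA.
  by rewrite (mul_bin_diag m.+2 t.+1) mulnCA mulnA.
have n1 : 1 <= n%:R :> R by rewrite ler1n (leq_trans _ sn) // ltnW.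
rewrite -(ler_pM2r M0) mulrAC -binE -[X in X <= _]mulrA.
apply: le_trans (_ : n%:R * (n%:R - 1) * (2 * M) <= _).
  by apply: ler_wpM2l => //; apply: mulr_ge0; lra.
rewrite mulrA ler_pM2r // [_ * 2]mulrC ler_pM2l // expr2 ler_pM2l //; lra.
Qed.

End BlockNumber.
End DerivativeBound.

(** * The expected cost *)
Section LogScale.
Variables (R : realType) (gamma : R).
Hypothesis gamma01 : 0 < gamma < 1.

(** The exponential of [log_scale q] is at least 1/q and 1/(1-q) when
[q <= 1 - gamma]; the summand 4 is used to integrate the differential
inequality. *)
Definition log_scale q : R := 4 + gamma^-1 - ln q.

Lemma log_scale_ge4 q : 0 < q <= 1 - gamma -> 4 <= log_scale q.
Proof.
have /andP[gam0 gam1] := gamma01.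
case/andP=> q0 q1; have : ln q <= 0 by apply: ln_le0; lra.
have : 0 < gamma^-1 by rewrite invr_gt0.
rewrite /log_scale; lra.
Qed.

Lemma inv_le_expR_log_scale q : 0 < q <= 1 - gamma ->
  q^-1 <= expR (log_scale q) /\ (1 - q)^-1 <= expR (log_scale q).
Proof.
have /andP[gam0 gam1] := gamma01.
case/andP=> q0 q1; have l0 : ln q <= 0 by apply: ln_le0; lra.
have gi : 0 < gamma^-1 by rewrite invr_gt0.
split.
  apply: le_trans (_ : expR (- ln q) <= _); last by rewrite ler_expR /log_scale; lra.
  by rewrite expRN lnK.
apply: le_trans (_ : gamma^-1 <= _); first by rewrite lef_pV2 ?posrE; lra.
apply: le_trans (expR_ge1Dx (log_scale q)); rewrite /log_scale; lra.
Qed.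

End LogScale.

Section ExpectedCost.
Variables (R : realType) (U : finType) (gamma : R).
Let n := #|U|.
Let V := vpairs U.
Let y : R := ln n%:R.
Let S := Num.truncn y.
Hypothesis gamma01 : 0 < gamma < 1.
Hypothesis y_ge2 : 2 <= y.
Hypothesis y_n : 4 * y ^+ 22 <= n%:R.

Local Notation log_scale := (log_scale gamma).

Let n_gt0 : 0 < n%:R :> R.
Proof.
have /andP[gam0 gam1] := gamma01; have y2 := y_ge2; have yn := y_n.
by apply: lt_le_trans y_n; rewrite mulr_gt0 // exprn_gt0; lra.
Qed.

Let y_le_n : y <= n%:R.
Proof. by apply/ltW/ln_sublinear. Qed.

Let S_le : S%:R <= y. Proof. by have y2 := y_ge2; rewrite truncn_le; lra. Qed.
Let S_gt1 : (1 < S)%N. Proof. by have y2 := y_ge2; rewrite /S truncn_ge_nat; lra. Qed.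

(** The clique size is s = floor(x) with x = ln n / (6 log_scale q), for which
Pi^(3s) is at most the square root of n; the hypothesis [y_n] says that the
power of [S <= ln n] in [block_slope_le] is at most the other square root.  When
[x < 2] there is no such clique size, but then the trivial bound by the number
of pairs suffices. *)
Lemma block_slope_le_log_scale q : 0 < q <= 1 - gamma ->
  block_slope U q S <= 324 * (n%:R ^+ 2 / y ^+ 2) * log_scale q ^+ 2.
Proof.
have /andP[gam0 gam1] := gamma01; have y2 := y_ge2; have yn := y_n.
have yn' := y_le_n; have Sy := S_le.
move=> q01; have b4 := log_scale_ge4 gamma01 q01; have [qP qP'] := inv_le_expR_log_scale gamma01 q01.
have q01' : 0 < q < 1 by case/andP: q01 => q0 q1; rewrite q0; lra.
pose x := y / (6 * log_scale q).
have l0 : 0 < 6 * log_scale q by lra.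
have x0 : 0 < x by rewrite divr_gt0; lra.
have -> : 324 * (n%:R ^+ 2 / y ^+ 2) * log_scale q ^+ 2 = 9 * n%:R ^+ 2 / x ^+ 2.
  by rewrite /x; field; lra.
rewrite ler_pdivlMr ?exprn_gt0 //.
case: (ltP x 2) => x2.
  have bV : block_slope U q S <= n%:R ^+ 2.
    apply: le_trans (block_slope_le_card U q01' S) _.
    by rewrite card_draws -natrX ler_nat bin_le_exp.
  apply: le_trans (_ : n%:R ^+ 2 * x ^+ 2 <= _); first by rewrite ler_wpM2r ?exprn_ge0 // ltW.
  have x24 : x ^+ 2 <= 2 ^+ 2 by apply: lerXn2r; rewrite ?nnegrE ?ltW.
  by rewrite mulrC; apply: ler_wpM2r; [rewrite exprn_ge0 // ltW | lra].
pose s := Num.truncn x.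
have /andP[sx xs] : s%:R <= x < s.+1%:R by apply: truncn_itv; lra.
have s2 : (1 < s)%N by rewrite /s truncn_ge_nat; lra.
have xy : x <= y by rewrite ler_pdivrMr // ler_peMr; lra.
have sS : (s <= S)%N by apply: le_truncn.
have sn : (s <= n)%N by rewrite -(ler_nat R); lra.
have cond : 2 * S%:R ^+ 11 * expR (log_scale q) ^+ (3 * s) <= n%:R.
  have nE : n%:R = expR (y / 2) ^+ 2 by rewrite -expRM_natl mulrC divfK // lnK.
  have e0 := expR_gt0 (y / 2).
  rewrite nE expr2; apply: ler_pM; rewrite ?mulr_ge0 ?exprn_ge0 ?expR_ge0 //.
    apply: le_trans (_ : 2 * y ^+ 11 <= _).
      rewrite ler_pM2l //; apply: lerXn2r; rewrite ?nnegrE ?ler0n //; exact: le_trans (ler0n _ _) Sy.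
    have sq : (2 * y ^+ 11) ^+ 2 <= expR (y / 2) ^+ 2.
      by rewrite -nE exprMn -exprM; apply: le_trans yn; rewrite -natrX.
    by rewrite -ler_sqr ?nnegrE ?expR_ge0 // mulr_ge0 // exprn_ge0 //; lra.
  rewrite -expRM_natl ler_expR natrM.
  have : s%:R * (6 * log_scale q) <= y by rewrite -ler_pdivlMr.
  lra.
have := block_slope_le q01' qP qP' S_gt1 _ sn cond; rewrite s2 sS => /(_ isT) bs.
clear cond yn qP qP'; rewrite -natr1 in xs; have s2' : 2 <= s%:R :> R by rewrite ler_nat.
rewrite -/n in bs; case: (lerP (block_slope U q S) 0) => b0.
  apply: le_trans (_ : 0 <= _); first by rewrite mulr_le0_ge0 // exprn_ge0 // ltW.
  by rewrite mulr_ge0 // exprn_ge0.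
(* [9 s (s - 1) >= 2 (s + 1) ^ 2] for [s >= 2]. *)
have x2s : 2 * x ^+ 2 <= 9 * (s%:R * (s%:R - 1)).
  have : x ^+ 2 <= (s%:R + 1) ^+ 2 by apply: lerXn2r; rewrite ?nnegrE; lra.
  have : 0 <= (7 * s%:R + 1) * (s%:R - 2) :> R by apply: mulr_ge0; lra.
  lra.
have : block_slope U q S * (2 * x ^+ 2) <= block_slope U q S * (9 * (s%:R * (s%:R - 1))).
  by rewrite ler_pM2l.
lra.
Qed.

(** The function q (log_scale q)^2 has derivative b^2 - 2b with b = log_scale q,
and 2 (b^2 - 2b) >= b^2 because b >= 4.  So the expected cost minus 648 = 2 * 324
times this function, suitably scaled, is nonincreasing.  It is compared at p and
at p/n, where the expected number of edges is already small enough. *)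
Lemma expect_block_cost_le p : 0 < p <= 1 - gamma ->
  expect V p (block_cost R S) <= 649 * (n%:R ^+ 2 * p / y ^+ 2) * log_scale p ^+ 2.
Proof.
have /andP[gam0 gam1] := gamma01; have y2 := y_ge2; have yn := y_n.
have yn' := y_le_n.
move=> p01; have p0 : 0 < p by case/andP: p01.
pose c := n%:R ^+ 2 / y ^+ 2; have y0 : 0 < y by lra.
have c0 : 0 < c by rewrite divr_gt0 ?exprn_gt0.
pose H q := expect V q (block_cost R S) - 648 * c * (q * log_scale q ^+ 2).
pose dH q := block_slope U q S - 648 * c * (log_scale q ^+ 2 - 2 * log_scale q).
pose p' := p / n%:R.
have n1 : 1 <= n%:R :> R by lra.
have p'0 : 0 < p' by rewrite divr_gt0.
have p'p : p' <= p by rewrite ler_pdivrMr // ler_peMr // ltW.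
have in01 q : p' <= q <= p -> 0 < q <= 1 - gamma.
  by move=> /andP[p'q qp]; case/andP: p01 => _ pg; apply/andP; split; lra.
have dHE q : p' <= q <= p -> is_derive q 1 H (dH q).
  move=> /in01/andP[q0 q1].
  have dl : is_derive q 1 log_scale (- q^-1).
    exact: is_derive_eq (is_deriveB (is_derive_cst _ q 1) (is_derive1_ln q0)) (sub0r _).
  have de := is_derive_expect V (block_cost R S) q.
  have dq := is_deriveM (is_derive_cst (648 * c) q 1) (is_deriveM (is_derive_id q 1) (is_deriveX 2 dl)).
  apply: is_derive_eq (is_deriveB de dq) _.
  rewrite -/(block_slope U q S) /GRing.scale /= /dH; rewrite mulr0 addr0 -[(log_scale ^+ 2) q]/(log_scale q ^+ 2).
  by move: (log_scale q) => b; field; rewrite gt_eqF.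
have dH0 q : p' <= q <= p -> dH q <= 0.
  move=> /in01 q01; have := block_slope_le_log_scale q01; have := log_scale_ge4 gamma01 q01.
  rewrite /dH -/c; set b := log_scale q => b4 sl.
  have : 0 <= 324 * c * (b * (b - 4)).
    have b0 : 0 <= b by apply: le_trans b4.
    have bb : 0 <= b * (b - 4) by apply: mulr_ge0; rewrite // subr_ge0.
    apply: mulr_ge0 bb; apply: mulr_ge0 (ltW c0); exact: ler0n.
  rewrite -/c in sl; lra.
have [d dpp E] : exists2 d, d \in `[p', p] & H p - H p' = dH d * (p - p').
  apply: MVT_segment => // [q|].
    by rewrite in_itv /= => /andP[/ltW a /ltW b]; apply: dHE; rewrite a b.
  apply: derivable_within_continuous => q; rewrite in_itv /= => qpp.
  by have [] := dHE q qpp.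
have Hle : H p <= H p'.
  rewrite -subr_le0 E; apply: mulr_le0_ge0; last by rewrite subr_ge0.
  by apply: dH0; move: dpp; rewrite in_itv.
have cost p1 : 0 <= p1 <= 1 -> expect V p1 (block_cost R S) <= #|V|%:R * p1.
  move=> p11; apply: le_trans (_ : expect V p1 (fun A => #|A|%:R) <= _).
    apply: expect_le => // A _; rewrite ler_nat; apply: block_number_card.
    exact: clique_blocks_single.
  by rewrite expect_card.
have Vn : #|V|%:R <= n%:R ^+ 2 :> R by rewrite card_draws -natrX ler_nat bin_le_exp.
have y2n : y ^+ 2 <= n%:R.
  apply: le_trans yn; apply: le_trans (_ : y ^+ 22 <= _); first by apply: ler_weXn2l => //; lra.
  by have : 0 <= y ^+ 22; [rewrite exprn_ge0 // ltW | lra].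
have b1 : 1 <= log_scale p ^+ 2 by have := log_scale_ge4 gamma01 p01 => b4; apply: exprn_ege1; apply: le_trans b4; rewrite ler1n.
have pg : p <= 1 - gamma by case/andP: p01.
have cp0 : 0 < c * p by rewrite mulr_gt0.
have cost' : expect V p' (block_cost R S) <= c * p * log_scale p ^+ 2.
  apply: le_trans (cost p' _) _; first by rewrite ltW // (le_trans p'p) // (le_trans pg) //; lra.
  apply: le_trans (_ : n%:R ^+ 2 * p' <= _); first by apply: ler_wpM2r; rewrite // ltW.
  apply: le_trans (_ : c * p <= _); last by rewrite ler_peMr // ltW.
  have -> : n%:R ^+ 2 * p' = n%:R * p by rewrite /p'; field; lra.
  apply: ler_wpM2r; first exact: ltW.
  by rewrite /c ler_pdivlMr ?exprn_gt0 // expr2 ler_pM2l.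
have l0 : 0 <= 648 * c * (p' * log_scale p' ^+ 2).
  apply: mulr_ge0; last exact: mulr_ge0 (ltW p'0) (sqr_ge0 _).
  by apply: mulr_ge0 (ltW c0); exact: ler0n.
have -> : 649 * (n%:R ^+ 2 * p / y ^+ 2) * log_scale p ^+ 2 = 648 * c * (p * log_scale p ^+ 2) + c * p * log_scale p ^+ 2.
  by rewrite /c; field; lra.
move: Hle; rewrite /H; lra.
Qed.

End ExpectedCost.

(** * From random edge sets to random graphs *)
Section Transfer.
Variables (R : realType) (n : nat) (p : R).
Implicit Types (G : sgraph 'I_n).

Lemma gnp_mass_sum (f : {set {set 'I_n}} -> R) :
  \sum_G gnp_mass p G * f (edges G) = expect (vpairs 'I_n) p f.
Proof.
rewrite /expect (reindex_omap (@edges 'I_n) (fun E => insub E : option (sgraph 'I_n))) /=; last first.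
  by move=> E EV; rewrite insubT.
apply: eq_big => [G|G _]; first by rewrite valK eqxx edges_vpairs.
congr (_ * _); rewrite /gnp_mass (big_setID (edges G)) /=.
rewrite (setIidPr (edges_vpairs G)); congr (_ * _).
  by rewrite (eq_bigr (fun=> p)) ?prodr_const // => e ->.
by rewrite (eq_bigr (fun=> 1 - p)) ?prodr_const // => e; rewrite inE => /andP[/negbTE ->].
Qed.

Lemma gnp_prob_le1 (E : pred (sgraph 'I_n)) : 0 <= p <= 1 -> gnp_prob p E <= 1.
Proof.
move=> p01; rewrite -(gnp_probT n p) /gnp_prob big_mkcond /=; apply: ler_sum => G _.
by case: ifP => // _; apply: gnp_mass_ge0.
Qed.

(** A union bound: [bad] is meant to be a sum of indicators of bad events. *)
Lemma gnp_prob_ge (E : pred (sgraph 'I_n)) (bad : {set {set 'I_n}} -> R) :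
  0 <= p <= 1 -> (forall A, 0 <= bad A) -> (forall G, bad (edges G) < 1 -> E G) ->
  1 - expect (vpairs 'I_n) p bad <= gnp_prob p E.
Proof.
move=> p01 bad0 badE; rewrite lerBlDr -gnp_mass_sum -(gnp_probT n p) /gnp_prob.
rewrite [X in _ <= X + _]big_mkcond -big_split /=; apply: ler_sum => G _.
have m0 := gnp_mass_ge0 G p01; have b0 := bad0 (edges G).
case: ifP => [_|/negbT EG]; first by rewrite lerDl mulr_ge0.
rewrite add0r ler_peMr // leNgt; apply: contra EG => /badE; exact.
Qed.

End Transfer.

(** * Edges and cliques of the random graph *)
Section RandomGraph.
Variable (R : realType).

Lemma expect_subset (T : finType) (V K : {set T}) (p : R) : 0 < p < 1 -> K \subset V ->
  expect V p (fun A => (K \subset A)%:R) = p ^+ #|K|.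
Proof.
move=> p01 KV; have <- : p ^+ #|K| * expect V p (likelihood p true K) = p ^+ #|K|.
  by rewrite expect_likelihood // mulr1.
rewrite -expectZ; apply: eq_expect => A _; rewrite /likelihood -prodr_const -big_split /=.
have p0 : p != 0 by case/andP: p01 => p0 _; rewrite gt_eqF.
case: (boolP (K \subset A)) => [/subsetP KA|/subsetPn[e eK eA]].
  by rewrite big1 // => e /KA ->; rewrite eqxx mul1r mulfV.
by rewrite (bigD1 e) //= (negbTE eA) mul0r mulr0 mul0r.
Qed.

(** The odd number of vertices 2m+1 makes binom(2m+1, 2) = m(2m+1) a multiple of
the number of vertices, so that the first moment is a perfect power. *)
Lemma expect_cliques (U : finType) (p : R) m : 0 < p < 1 ->
  expect (vpairs U) p (fun A => \sum_(Q : {set U} | #|Q| == m.*2.+1) (pairs_in Q \subset A)%:R)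
  <= (#|U|%:R * p ^+ m) ^+ m.*2.+1.
Proof.
move=> p01; rewrite expect_sum.
rewrite (eq_bigr (fun=> (p ^+ m) ^+ m.*2.+1)); last first.
  move=> Q /eqP cQ; rewrite expect_subset ?pairs_in_vpairs // card_pairs_in cQ.
  by rewrite -exprM bin2 /= -doubleMr doubleK mulnC.
rewrite sumr_const -cardsE card_draws -[X in X <= _]mulr_natl exprMn; apply: ler_wpM2r.
  by case/andP: p01 => /ltW p0 _; rewrite !exprn_ge0.
by rewrite -natrX ler_nat bin_le_exp.
Qed.

Lemma clique_size_le (U : finType) (G : sgraph U) k :
  (forall Q : {set U}, #|Q| == k.+1 -> ~~ (pairs_in Q \subset edges G)) ->
  forall Q, clique G Q -> (#|Q| <= k)%N.
Proof.
move=> noK Q; rewrite cliqueE leqNgt => QG; apply/negP => kQ.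
have : (0 < #|[set J : {set U} | (J \subset Q) && (#|J| == k.+1)]|)%N.
  by rewrite cards_draws bin_gt0.
case/card_gt0P => J; rewrite inE => /andP[JQ cJ].
apply/negP: (noK J cJ); rewrite negbK; apply: subset_trans QG.
by apply/subsetP => e; rewrite !inE => /andP[-> /subset_trans ->].
Qed.

Lemma variance_card (T : finType) (V : {set T}) (p : R) : 0 <= p <= 1 ->
  variance V p (fun A => #|A|%:R) <= #|V|%:R * p.
Proof.
move=> p01; have := @variance_le _ _ V p (fun A => #|A|%:R) 1 p01.
rewrite expr1n mulr1; apply=> e A eA.
by rewrite cardsU1 eA natrD addrK normr1.
Qed.

End RandomGraph.

(** * Explicit bounds for a fixed number of vertices *)
Section FiniteEstimate.
Variables (R : realType).

Definition clique_scale n (p : R) : R := n%:R ^+ 2 * p / log_base p^-1 n%:R ^+ 2.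

Definition clique_numbers_within (c C p : R) n (G : sgraph 'I_n) : bool :=
  [&& c * clique_scale n p <= (cc G)%:R, (cc G <= cp G)%N & (cp G)%:R <= C * clique_scale n p].

Lemma card_vpairs (U : finType) : 2 * #|vpairs U|%:R = #|U|%:R * (#|U|%:R - 1) :> R.
Proof.
rewrite card_draws; case: #|U| => [|n]; first by rewrite mulr0 mul0r.
have -> : n.+1%:R - 1 = n%:R :> R by rewrite -natr1 addrK.
by rewrite -!natrM -(mul_bin_diag n.+1 1) bin1.
Qed.

(** All cliques have at most [2m] vertices, hence at most [2m^2] edges, and the
number of edges is at least [n^2 p / 8]. *)
Lemma cc_lower_bound (n m : nat) (p : R) (G : sgraph 'I_n) : 0 <= p -> 2 <= n%:R :> R ->
  #|vpairs 'I_n|%:R * p / 2 <= #|edges G|%:R ->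
  (forall Q : {set 'I_n}, #|Q| == m.*2.+1 -> ~~ (pairs_in Q \subset edges G)) ->
  n%:R ^+ 2 * p <= 16 * m%:R ^+ 2 * (cc G)%:R.
Proof.
move=> p0 n2 eG /clique_size_le/card_edges_le_cc ec.
have {}ec : #|edges G|%:R <= (cc G)%:R * (2 * m%:R ^+ 2) :> R.
  rewrite -natrX -!natrM ler_nat; apply: leq_trans ec _; rewrite leq_mul2l; apply/orP; right.
  rewrite bin2 -doubleMl doubleK mulnC expnS expn1 mulnA leq_mul2r.
  by apply/orP; right; rewrite mul2n leq_pred.
have := card_vpairs 'I_n; rewrite card_ord; move: eG ec p0 n2.
move: (#|vpairs _|%:R) (#|edges G|%:R) (cc G)%:R (n%:R : R) (m%:R : R) => v e k x z.
move=> eG ec p0 x2 v2.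
have v4 : x ^+ 2 <= 4 * v.
  have : 0 <= x * (x - 2) by apply: mulr_ge0; lra.
  lra.
have : x ^+ 2 * p <= 4 * v * p by apply: ler_wpM2r.
lra.
Qed.

(** Chebyshev's inequality; the mean number of edges tends to infinity exactly
when [n^2 p] does. *)
Lemma edges_deviation n (p : R) : 0 < p <= 1 -> 2 <= n%:R :> R ->
  expect (vpairs 'I_n) p (fun A => (#|vpairs 'I_n|%:R * p / 2 <=
     `|#|A|%:R - #|vpairs 'I_n|%:R * p|)%R%:R) <= 16 / (n%:R ^+ 2 * p).
Proof.
move=> /andP[p0 p1] n2; have p01 : 0 <= p <= 1 by rewrite ltW.
have V2 := card_vpairs 'I_n; rewrite card_ord in V2.
have variance_le_vp := variance_card (vpairs 'I_n) p01.
have Ecard := expect_card (vpairs 'I_n) p.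
have cheb := chebyshev p01 _ (esym Ecard).
move: V2 variance_le_vp cheb; move: (#|vpairs _|%:R) => v V2 variance_le_vp cheb.
have V4 : n%:R ^+ 2 <= 4 * v.
  have : 0 <= n%:R * (n%:R - 2) :> R by apply: mulr_ge0; lra.
  lra.
have n0 : 0 < n%:R :> R by lra.
have n20 : 0 < n%:R ^+ 2 :> R by rewrite exprn_gt0.
have v0 : 0 < v by lra.
have t0 : 0 < v * p / 2 by rewrite !mulr_gt0 // invr_gt0.
apply: le_trans (cheb _ t0) _.
apply: le_trans (_ : v * p / (v * p / 2) ^+ 2 <= _).
  by apply: ler_wpM2r; [rewrite invr_ge0 exprn_ge0 // ltW | exact: variance_le_vp].
rewrite (_ : v * p / _ = 4 / (v * p)); last by field; lra.
rewrite ler_pdivrMr ?mulr_gt0 // mulrAC ler_pdivlMr ?mulr_gt0 //.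
have : n%:R ^+ 2 * p <= 4 * v * p by rewrite ler_pM2r.
lra.
Qed.

(** The assumption on [m] means that [p ^ m <= n ^ -2], so the first moment
(n p^m)^(2m+1) is at most 1/n. *)
Lemma large_cliques n m (p : R) : 0 < p < 1 -> 1 <= n%:R :> R ->
  2 * ln n%:R <= m%:R * - ln p ->
  expect (vpairs 'I_n) p
    (fun A => \sum_(Q : {set 'I_n} | #|Q| == m.*2.+1) (pairs_in Q \subset A)%:R)
  <= n%:R^-1.
Proof.
move=> p01 n1 mp; have n0 : 0 < n%:R :> R by lra.
have p0 : 0 < p by case/andP: p01.
apply: le_trans (expect_cliques _ _ p01) _; rewrite card_ord.
have pm : n%:R * p ^+ m <= n%:R^-1.
  have -> : p ^+ m = expR (- (m%:R * - ln p)).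
    by rewrite mulrN opprK mulr_natl -lnXn // lnK // posrE exprn_gt0.
  rewrite -ler_pdivlMl // (_ : _^-1 * _^-1 = expR (- (2 * ln n%:R))); last first.
    by rewrite expRN expRM_natl lnK ?posrE // expr2 invfM.
  by rewrite ler_expR lerN2.
have pm0 : 0 <= n%:R * p ^+ m by rewrite mulr_ge0 ?exprn_ge0 // ltW.
apply: le_trans (pm); rewrite exprS ler_piMr // exprn_ile1 //.
by apply: le_trans pm _; rewrite invf_le1.
Qed.

Section FixedSize.
Variables (n : nat) (p gamma : R).
Let y : R := ln n%:R.
Let V := vpairs 'I_n.
Let S := Num.truncn y.
Hypotheses (gamma01 : 0 < gamma < 1) (y_ge2 : 2 <= y) (y_n : 4 * y ^+ 22 <= n%:R).
Hypotheses (p0 : 0 < p) (p1 : p <= 1 - gamma).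

Let f := block_cost R (U := 'I_n) S.
Let t := n%:R ^+ 2 * p * log_scale gamma p ^+ 2 / y ^+ 2.

Let n_gt0 : 0 < n%:R :> R.
Proof. by apply: lt_le_trans y_n; rewrite mulr_gt0 // exprn_gt0 // (lt_le_trans _ y_ge2). Qed.

Let y_gt0 : 0 < y. Proof. exact: lt_le_trans y_ge2. Qed.

Let y9 : y ^+ 9 <= n%:R.
Proof.
have y2 := y_ge2; have yn := y_n; have y0 := y_gt0.
have : y ^+ 9 <= y ^+ 22 by apply: ler_weXn2l => //; lra.
have : 0 <= y ^+ 22 by rewrite exprn_ge0 // ltW.
lra.
Qed.

Let y_le_n : y <= n%:R. Proof. exact/ltW/ln_sublinear. Qed.

Let p_lt1 : p < 1.
Proof. by case/andP: gamma01 => g0 _; apply: le_lt_trans p1 _; rewrite ltrBlDr ltrDl. Qed.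

(** The variance is O(n^2 p (ln n)^4) and [t] is at least n^2 p / (ln n)^2, so
Chebyshev's inequality gives (ln n)^8 / (n^2 p), which is small as soon as
[n p >= 1]. *)
Lemma cost_deviation : 1 <= n%:R * p ->
  expect V p (fun A => (t <= `|f A - expect V p f|)%R%:R) <= y^-1.
Proof.
move=> np; have y0 := y_gt0; have y2 := y_ge2; have n0 := n_gt0.
have p01 : 0 <= p <= 1 by rewrite !ltW.
have p01' : 0 < p < 1 by rewrite p0 p_lt1.
have p00 := p0.
have l4 : 4 <= log_scale gamma p by apply: log_scale_ge4; rewrite ?p0 ?p1.
have l1 : 1 <= log_scale gamma p ^+ 2 by apply: exprn_ege1; apply: le_trans l4; rewrite ler1n.
have t1 : n%:R ^+ 2 * p / y ^+ 2 <= t.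
  by rewrite /t ler_wpM2r ?invr_ge0 ?exprn_ge0 ?(ltW y0) // ler_peMr // mulr_ge0 ?exprn_ge0 ?(ltW p00) // ltW.
have t10 : 0 < n%:R ^+ 2 * p / y ^+ 2 by rewrite divr_gt0 ?mulr_gt0 ?exprn_gt0.
have t0 : 0 < t by apply: lt_le_trans t1.
apply: le_trans (chebyshev p01 t0 erefl) _.
have S2 : (1 < S)%N by rewrite /S truncn_ge_nat // ltW.
have Sy : S%:R <= y by rewrite truncn_le ltW.
have := variance_block_cost 'I_n p01' S2; rewrite card_ord -/f -/V => var.
rewrite ler_pdivrMr ?exprn_gt0 //; apply: le_trans var _.
apply: le_trans (_ : y^-1 * (n%:R ^+ 2 * p / y ^+ 2) ^+ 2 <= _); last first.
  apply: ler_wpM2l; first by rewrite invr_ge0 ltW.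
  by apply: lerXn2r; rewrite // nnegrE ltW.
apply: le_trans (_ : n%:R ^+ 2 * p * y ^+ 4 <= _).
  apply: ler_wpM2l; first by rewrite mulr_ge0 ?exprn_ge0 // ltW.
  by apply: lerXn2r; rewrite ?nnegrE ?ler0n ?(ltW y0).
have -> : y^-1 * (n%:R ^+ 2 * p / y ^+ 2) ^+ 2 = n%:R ^+ 2 * p * (n%:R * (n%:R * p) / y ^+ 5).
  by field; rewrite gt_eqF.
apply: ler_wpM2l; first by rewrite mulr_ge0 ?exprn_ge0 // ltW.
rewrite ler_pdivlMr ?exprn_gt0 // -exprD; apply: le_trans y9 _.
by rewrite ler_peMr // ltW.
Qed.


Let lam := - ln p.

Let lam_gt0 : 0 < lam.
Proof. by rewrite oppr_gt0 ln_lt0 // p0 p_lt1. Qed.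

Let gamma_gt0 : 0 < gamma. Proof. by case/andP: gamma01. Qed.

Lemma clique_scaleE : clique_scale n p = n%:R ^+ 2 * p * lam ^+ 2 / y ^+ 2.
Proof.
have y0 := y_gt0; have l0 := lam_gt0.
rewrite /clique_scale /log_base lnV ?posrE // -/lam -/y; field.
by rewrite !gt_eqF.
Qed.

(** The upper constant depends on [gamma] only through this comparison of
[log_scale gamma p] with ln(1/p), which is at least [gamma]. *)
Definition log_scale_ratio : R := (4 + gamma^-1) / gamma + 1.

Let lam_ge_gamma : gamma <= lam.
Proof.
have p1' := p1; have p0' := p0.
have : ln (1 + (p - 1)) <= p - 1 by apply: le_ln1Dx; lra.
rewrite addrC subrK /lam; lra.
Qed.

Lemma log_scale_le : log_scale gamma p <= log_scale_ratio * lam.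
Proof.
have g0 := gamma_gt0; rewrite /log_scale_ratio mulrDl mul1r /log_scale -/lam lerD2r.
rewrite -mulrA ler_peMr //; first by rewrite addr_ge0 // invr_ge0 ltW.
by rewrite mulrC ler_pdivlMr // mul1r.
Qed.

Lemma cp_upper_bound_dense (G : sgraph 'I_n) :
  `|f (edges G) - expect V p f| <= t ->
  (cp G)%:R <= 650 * log_scale_ratio ^+ 2 * clique_scale n p.
Proof.
move=> dev; have y0 := y_gt0; have l0 := lam_gt0.
have cpf : (cp G)%:R <= f (edges G) by rewrite ler_nat cp_le_block_number.
have F : expect V p f <= 649 * (n%:R ^+ 2 * p / y ^+ 2) * log_scale gamma p ^+ 2.
  have := @expect_block_cost_le R 'I_n gamma gamma01.
  by rewrite card_ord => /(_ y_ge2 y_n p); apply; rewrite p0 p1.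
have {dev} : f (edges G) <= expect V p f + t by rewrite addrC -lerBlDr; apply: le_trans dev; apply: ler_norm.
have b2 : log_scale gamma p ^+ 2 <= log_scale_ratio ^+ 2 * lam ^+ 2.
  rewrite -exprMn; apply: lerXn2r; rewrite ?nnegrE ?log_scale_le //.
    by apply: le_trans (log_scale_ge4 gamma01 _); rewrite ?p0 ?p1.
  by apply: le_trans log_scale_le; apply: le_trans (log_scale_ge4 gamma01 _); rewrite ?p0 ?p1.
have c0 : 0 <= 650 * (n%:R ^+ 2 * p / y ^+ 2).
  apply: mulr_ge0 (ler0n _ _) _.
  by rewrite divr_ge0 ?mulr_ge0 ?exprn_ge0 ?(ltW p0) ?(ltW y0).
have := ler_wpM2l c0 b2.
rewrite clique_scaleE /t; move: (f _) (expect _ _ _) cpf F => a b cpf F.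
have -> : 650 * log_scale_ratio ^+ 2 * (n%:R ^+ 2 * p * lam ^+ 2 / y ^+ 2) =
  650 * (n%:R ^+ 2 * p / y ^+ 2) * (log_scale_ratio ^+ 2 * lam ^+ 2) by ring.
have -> : n%:R ^+ 2 * p * log_scale gamma p ^+ 2 / y ^+ 2 =
  n%:R ^+ 2 * p / y ^+ 2 * log_scale gamma p ^+ 2 by ring.
move: F {c0 b2}; move: (n%:R ^+ 2 * p / y ^+ 2) (log_scale gamma p ^+ 2) => c b2.
move: (log_scale_ratio ^+ 2 * _) ((cp G)%:R : R) cpf => X k *; lra.
Qed.

(** For [n p < 1] the base-1/p logarithm of [n] is at most 1, so [n ^ 2 * p]
cliques are affordable and single edges do. *)
Lemma cp_upper_bound_sparse (G : sgraph 'I_n) : n%:R * p < 1 ->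
  `|#|edges G|%:R - #|V|%:R * p| <= #|V|%:R * p / 2 ->
  (cp G)%:R <= 650 * log_scale_ratio ^+ 2 * clique_scale n p.
Proof.
move=> np dev; have y0 := y_gt0; have l0 := lam_gt0; have n0 := n_gt0; have p0' := p0.
have cpe : (cp G)%:R <= #|edges G|%:R :> R.
  rewrite ler_nat; apply: leq_trans (cp_le_block_number G S) _.
  exact: block_number_card (clique_blocks_single S) _.
have eV : #|edges G|%:R <= #|V|%:R * p + #|V|%:R * p / 2 :> R.
  by rewrite addrC -lerBlDr; apply: le_trans dev; apply: ler_norm.
have nn : #|V|%:R * p + #|V|%:R * p / 2 <= n%:R ^+ 2 * p.
  have := card_vpairs 'I_n; rewrite card_ord -/V; move: (#|V|%:R : R) => v v2.
  rewrite (_ : v * p + _ = 3 / 2 * v * p); last by field.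
  rewrite ler_pM2r //; have : 0 <= n%:R ^+ 2 :> R by rewrite exprn_ge0.
  lra.
have ly : y <= lam.
  have : ln (n%:R * p) <= 0 by apply/ln_le0/ltW.
  rewrite lnM ?posrE // -/y /lam; lra.
have K1 : 1 <= log_scale_ratio.
  rewrite /log_scale_ratio lerDr divr_ge0 ?addr_ge0 ?invr_ge0 //; exact: ltW gamma_gt0.
apply: le_trans cpe (le_trans eV (le_trans nn _)); rewrite clique_scaleE -mulrA.
have np0 : 0 <= n%:R ^+ 2 * p by rewrite mulr_ge0 ?exprn_ge0 // ltW.
rewrite (_ : 650 * _ = n%:R ^+ 2 * p * (650 * (log_scale_ratio ^+ 2 * (lam ^+ 2 / y ^+ 2)))); last by ring.
rewrite ler_peMr //.
have r1 : 1 <= lam ^+ 2 / y ^+ 2.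
  by rewrite ler_pdivlMr ?exprn_gt0 // mul1r; apply: lerXn2r; rewrite // nnegrE ltW.
have K2 : 1 <= log_scale_ratio ^+ 2 by apply: exprn_ege1.
have : 1 <= log_scale_ratio ^+ 2 * (lam ^+ 2 / y ^+ 2) by apply: mulr_ege1.
lra.
Qed.

(** The constant 1/256 comes from [m <= 4L] in the bound
n^2 p <= 16 m^2 cc(G); this uses L >= 1/2, which is [1 <= n ^ 2 * p]. *)
Lemma clique_numbers_probability : 1 <= n%:R ^+ 2 * p ->
  1 - (16 / (n%:R ^+ 2 * p) + 2 / y)
    <= gnp_prob p (@clique_numbers_within (256^-1) (650 * log_scale_ratio ^+ 2) p n).
Proof.
move=> n2p; have y0 := y_gt0; have y2 := y_ge2; have l0 := lam_gt0; have n0 := n_gt0.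
have p0' := p0; have yn := y_le_n.
have p01 : 0 < p < 1 by rewrite p0 p_lt1.
have p01w : 0 <= p <= 1 by rewrite !ltW ?p_lt1.
have n2 : 2 <= n%:R :> R by lra.
have l2y : lam <= 2 * y.
  have : 0 <= ln (n%:R ^+ 2 * p) by apply: ln_ge0.
  rewrite lnM ?posrE ?exprn_gt0 // lnXn // -/y /lam; lra.
pose L := y / lam; have L0 : 0 < L by rewrite divr_gt0.
have L2 : 1 <= 2 * L by rewrite /L mulrA ler_pdivlMr // mul1r.
pose m := (Num.truncn (2 * L)).+1.
have mL : 2 * L <= m%:R by apply/ltW/truncnS_gt.
have mL4 : m%:R <= 4 * L.
  have tL : (Num.truncn (2 * L))%:R <= 2 * L by rewrite truncn_le (le_trans _ L2).
  have -> : m%:R = (Num.truncn (2 * L))%:R + 1 :> R by rewrite natr1.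
  lra.
pose bad1 (A : {set {set 'I_n}}) : R := (#|V|%:R * p / 2 <= `|#|A|%:R - #|V|%:R * p|)%R%:R.
pose bad2 (A : {set {set 'I_n}}) : R :=
  \sum_(Q : {set 'I_n} | #|Q| == m.*2.+1) (pairs_in Q \subset A)%:R.
pose bad3 (A : {set {set 'I_n}}) : R := ((1 <= n%:R * p) && (t <= `|f A - expect V p f|))%R%:R.
have b10 A : 0 <= bad1 A by apply: ler0n.
have b20 A : 0 <= bad2 A by apply: sumr_ge0 => Q _; apply: ler0n.
have b30 A : 0 <= bad3 A by apply: ler0n.
apply: le_trans (gnp_prob_ge (bad := fun A => bad1 A + bad2 A + bad3 A) p01w _ _).
- rewrite lerD2l lerN2 !expectD.
  have e1 : expect V p bad1 <= 16 / (n%:R ^+ 2 * p) 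
    by apply: edges_deviation => //; rewrite p0 (ltW p_lt1).
  have e2 : expect V p bad2 <= y^-1.
    apply: le_trans (large_cliques (n := n) (m := m) p01 _ _) _; first by lra.
      rewrite -/lam -/y -ler_pdivrMr //; by rewrite -mulrA.
    by rewrite lef_pV2 ?posrE.
  have e3 : expect V p bad3 <= y^-1.
    case: (lerP 1 (n%:R * p)) => np.
      by rewrite /bad3 np; apply: cost_deviation.
    by rewrite /bad3 (lt_geF np) expect_cst invr_ge0 ltW.
  lra.
- by move=> A; rewrite !addr_ge0.
move=> G bad.
have d1 : ~~ (#|V|%:R * p / 2 <= `|#|edges G|%:R - #|V|%:R * p|).
  apply: contraTN bad => d1; rewrite -leNgt /bad1 d1 -addrA lerDl addr_ge0 //.
have d2 (Q : {set 'I_n}) : #|Q| == m.*2.+1 -> ~~ (pairs_in Q \subset edges G).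
  move=> cQ; apply: contraTN bad => d2; rewrite -leNgt.
  apply: le_trans (_ : bad2 (edges G) <= _).
    by rewrite /bad2 (bigD1 Q) //= d2 lerDl; apply: sumr_ge0 => ? _; apply: ler0n.
  by rewrite -addrA addrC -addrA lerDl addr_ge0.
have d3 : ~~ ((1 <= n%:R * p) && (t <= `|f (edges G) - expect V p f|)).
  apply: contraTN bad => d3; rewrite -leNgt /bad3 d3 lerDr addr_ge0 //.
rewrite -ltNge in d1; rewrite /clique_numbers_within cc_le_cp /=; apply/andP; split; last first.
  move: d3; case: (lerP 1 (n%:R * p)) => np /=.
    by rewrite -ltNge => /ltW; apply: cp_upper_bound_dense.
  by move=> _; apply: cp_upper_bound_sparse => //; apply: ltW.
have eG : #|V|%:R * p / 2 <= #|edges G|%:R.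
  move: d1; rewrite ltr_norml => /andP[]; move: (#|V|%:R * p) => v; move: (#|edges G|%:R : R) => e; lra.
have low := cc_lower_bound (ltW p0) n2 eG d2.
have -> : 256^-1 * clique_scale n p = n%:R ^+ 2 * p / (256 * L ^+ 2).
  by rewrite clique_scaleE /L; field; rewrite !gt_eqF.
have L20 : 0 < 256 * L ^+ 2 by apply: mulr_gt0; [exact: ltr0n | exact: exprn_gt0].
rewrite ler_pdivrMr //; apply: le_trans low _.
rewrite mulrC; apply: ler_wpM2l; first exact: ler0n.
have : m%:R ^+ 2 <= (4 * L) ^+ 2 by apply: lerXn2r; rewrite // nnegrE ?ler0n // mulr_ge0 // ltW.
move: (m%:R : R) => z; lra.
Qed.

End FixedSize.
End FiniteEstimate.

(** * Asymptotics *)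
Lemma ln_nat_large (R : realType) (K : R) : \forall n \near \oo%classic, K <= ln n%:R.
Proof.
exists (Num.truncn (expR K)).+1 => // n /= Kn.
have eK : expR K <= n%:R.
  by apply/ltW/(lt_le_trans (truncnS_gt _)); rewrite ler_nat.
by rewrite -[X in X <= _]expRK ler_ln // posrE ?expR_gt0 // (lt_le_trans (expR_gt0 K)).
Qed.

(** From n = (exp(y / K))^K >= (y / K)^K with y = ln n and K = k + 1: one spare
factor y absorbs the constants. *)
Lemma ln_pow_le_nat (R : realType) (n k : nat) : (0 < n)%N ->
  4 * k.+1%:R ^+ k.+1 <= ln n%:R :> R -> 4 * ln n%:R ^+ k <= n%:R :> R.
Proof.
move=> n0; set y := ln _; set K : R := k.+1%:R => yK.
have K0 : 0 < K by rewrite ltr0n.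
have KK : 0 < K ^+ k.+1 by rewrite exprn_gt0.
have y0 : 0 <= y by apply: le_trans yK; apply: mulr_ge0 => //; apply: ltW.
have -> : n%:R = expR (y / K) ^+ k.+1.
  by rewrite -expRM_natl mulrC divfK ?gt_eqF // lnK // posrE ltr0n.
apply: le_trans (_ : (y / K) ^+ k.+1 <= _); last first.
  apply: lerXn2r; rewrite ?nnegrE ?expR_ge0 ?divr_ge0 ?(ltW K0) //.
  by apply: le_trans (expR_ge1Dx _); rewrite lerDr.
rewrite expr_div_n ler_pdivlMr // mulrAC [y ^+ k.+1]exprS; apply: ler_wpM2r => //.
by rewrite exprn_ge0.
Qed.

Theorem theorem4 (R : realType) :
  exists2 c : R, 0 < c &
  forall gamma : R, 0 < gamma < 1 ->
  exists2 C : R, 0 < C &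
  forall p : nat -> R,
    (forall n : nat, 0 <= p n <= 1 - gamma) ->
    much_less (fun n => (n%:R ^+ 2)^-1) p ->
    whp p (fun n (G : sgraph 'I_n) =>
      let b := n%:R ^+ 2 * p n / log_base (p n)^-1 n%:R ^+ 2 in
      [&& c * b <= (cc G)%:R,
          (cc G <= cp G)%N &
          (cp G)%:R <= C * b]).
Proof.
exists 256^-1; first by rewrite invr_gt0 (ltr0n R 256).
move=> gamma gamma01; have g0 : 0 < gamma by case/andP: gamma01.
have K0 : 0 < log_scale_ratio gamma.
  by rewrite /log_scale_ratio ltr_wpDl // divr_ge0 ?addr_ge0 ?invr_ge0 // ltW.
exists (650 * log_scale_ratio gamma ^+ 2); first exact: mulr_gt0 (ltr0Sn _ _) (exprn_gt0 _ K0).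
move=> p pg [pn0 small]; rewrite /whp.
apply/cvgrPdist_le => e e0.
have e32 : 0 < Num.min 1 (e / 32) by rewrite lt_min ltr01 divr_gt0.
move/cvgrPdist_le: small => /(_ _ e32) small.
near=> n.
have p0 : 0 < p n.
  have /andP[p0 _] := pg n; rewrite lt_neqAle p0 andbT eq_sym.
  by near: n.
have p1 : p n <= 1 - gamma by case/andP: (pg n).
have y2 : 2 <= ln n%:R :> R by near: n; exact: ln_nat_large.
have n0 : (0 < n)%N by rewrite lt0n; apply: contraTneq y2 => ->; rewrite ln0 // -ltNge.
have yn : 4 * ln n%:R ^+ 22 <= n%:R :> R.
  by apply: ln_pow_le_nat => //; near: n; exact: ln_nat_large.
have ye : 4 / e <= ln n%:R by near: n; exact: ln_nat_large.
have np : (n%:R ^+ 2)^-1 / p n <= Num.min 1 (e / 32).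
  suff : `|0 - (n%:R ^+ 2)^-1 / p n| <= Num.min 1 (e / 32).
    rewrite sub0r normrN ger0_norm //.
    by rewrite divr_ge0 ?(ltW p0) // invr_ge0 exprn_ge0.
  by near: n.
have n2p0 : 0 < n%:R ^+ 2 * p n by rewrite mulr_gt0 // exprn_gt0 // ltr0n.
rewrite -invfM le_min invf_le1 // in np; case/andP: np => np1 np32.
have := clique_numbers_probability gamma01 y2 yn p0 p1 np1.
have p01 : 0 <= p n <= 1 by rewrite ltW //= (le_trans p1) // gerBl ltW.
have := gnp_prob_le1 (@clique_numbers_within R (256^-1) (650 * log_scale_ratio gamma ^+ 2) (p n) n) p01.
rewrite /clique_numbers_within /clique_scale; set P := gnp_prob _ _ => P1 Pge.
rewrite ger0_norm ?subr_ge0 //.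
have y0 : 0 < ln n%:R :> R by apply: lt_le_trans y2.
have e2 : 2 / ln n%:R <= e / 2.
  by rewrite ler_pdivrMr // mulrAC ler_pdivlMr // -ler_pdivrMl // mulrC -(natrM _ 2 2).
lra.
Unshelve. all: by end_near.
Qed.
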